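(* Let $\mathfrak g$ be a compact simple Lie algebra and $\sigma=\mathrm{Ad}(\exp\frac{\pi}{2}\sqrt{-1}K_i)$ with $m_i=4$, so that $\mathfrak h=\mathfrak g^\sigma$ has center $\mathfrak z=0$. Let $\tau$ be an involution of $\mathfrak g$ such that $\tau(\mathfrak h)=\mathfrak h$, $\tau(\mathfrak t)=\mathfrak t$ and $\tau(\Pi(\mathfrak h))=\Pi(\mathfrak h)$, and suppose $\tau|_{\mathfrak t}\neq\mathrm{Id}_{\mathfrak t}$. Then $\tau|_{\mathfrak t}$ is one of the following (each map is described by its action on roots; since $\tau$ is involutive, the images of the roots not listed follow): Type I ($\mathfrak g=\mathfrak e_7$, $i=4$): $\alpha_1\mapsto\alpha_6,\ \alpha_2\mapsto\alpha_2,\ \alpha_3\mapsto\alpha_5,\ \alpha_4\mapsto\alpha_4,\ \alpha_7\mapsto\alpha_0$. Type II ($\mathfrak g=\mathfrak e_7$, $i=4$): $\alpha_1\mapsto\alpha_1,\ \alpha_2\mapsto\alpha_2,\ \alpha_3\mapsto\alpha_0,\ \alpha_5\mapsto\alpha_7,\ \alpha_6\mapsto\alpha_6,\ \alpha_4\mapsto\alpha_1+\alpha_2+2\alpha_3+3\alpha_4+2\alpha_5+\alpha_6$. Type III ($\mathfrak g=\mathfrak e_7$, $i=4$): $\alpha_1\mapsto\alpha_6,\ \alpha_2\mapsto\alpha_2,\ \alpha_3\mapsto\alpha_7,\ \alpha_5\mapsto\alpha_0,\ \alpha_4\mapsto\alpha_1+\alpha_2+2\alpha_3+3\alpha_4+2\alpha_5+\alpha_6$.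 Type IV ($\mathfrak g=\mathfrak e_8$, $i=3$): $\alpha_1\mapsto\alpha_1,\ \alpha_2\mapsto\alpha_0,\ \alpha_4\mapsto\alpha_8,\ \alpha_5\mapsto\alpha_7,\ \alpha_6\mapsto\alpha_6,\ \alpha_3\mapsto\alpha_1+2\alpha_2+3\alpha_3+4\alpha_4+3\alpha_5+2\alpha_6+\alpha_7$. Type V ($\mathfrak g=\mathfrak e_8$, $i=6$): $\alpha_1\mapsto\alpha_1,\ \alpha_2\mapsto\alpha_5,\ \alpha_3\mapsto\alpha_3,\ \alpha_4\mapsto\alpha_4,\ \alpha_7\mapsto\alpha_0,\ \alpha_8\mapsto\alpha_8,\ \alpha_6\mapsto\alpha_1+\alpha_2+2\alpha_3+3\alpha_4+3\alpha_5+3\alpha_6+2\alpha_7+\alpha_8$. Type VI ($\mathfrak g=\mathfrak f_4$, $i=3$): $\alpha_1\mapsto\alpha_1,\ \alpha_2\mapsto\alpha_0,\ \alpha_4\mapsto\alpha_4,\ \alpha_3\mapsto\alpha_1+2\alpha_2+3\alpha_3+\alpha_4$.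
   Context: $\mathfrak t$ is a maximal abelian subalgebra of $\mathfrak g$ contained in $\mathfrak h$, $\Pi=\{\alpha_1,\dots,\alpha_n\}$ a set of simple roots of $(\mathfrak g_{\mathbb C},\mathfrak t_{\mathbb C})$, $\delta=\sum_jm_j\alpha_j$ the highest root, $\alpha_0=-\delta$, and $K_j\in\mathfrak t_{\mathbb C}$ is given by $\alpha_i(K_j)=\delta_{ij}$. $\Pi(\mathfrak h)=\{\alpha_0\}\cup\{\alpha_j:j\neq i\}$ is the simple root system of $\mathfrak h$ (the extended Dynkin diagram of $\mathfrak g$ with $\alpha_i$ deleted). An automorphism $\tau$ with $\tau(\mathfrak t)=\mathfrak t$ acts on roots by $\tau(\alpha)=\alpha\circ\tau^{-1}|_{\mathfrak t_{\mathbb C}}$. Numbering: for $E_7,E_8$ the diagram is the chain $\alpha_1-\alpha_3-\alpha_4-\cdots-\alpha_n$ with $\alpha_2$ attached to $\alpha_4$; highest roots $E_7$: $(m_1,\dots,m_7)=(2,2,3,4,3,2,1)$, $E_8$: $(2,3,4,6,5,4,3,2)$, $F_4$ ($\alpha_1,\alpha_2$ long, chain $\alpha_1-\alpha_2\Rightarrow\alpha_3-\alpha_4$): $(2,3,4,2)$. *)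

(* Defs.v *)
From HB Require Import structures.
From mathcomp Require Import all_boot all_order all_algebra.
From mathcomp Require Import complex.
From mathcomp Require Import boolp classical_sets reals topology.
From mathcomp Require Import normedtype sequences trigo.

Set Implicit Arguments.
Unset Strict Implicit.
Unset Printing Implicit Defensive.

Import Order.TTheory GRing.Theory Num.Theory.
Import numFieldNormedType.Exports.

Local Open Scope classical_set_scope.
Local Open Scope complex_scope.
Local Open Scope ring_scope.

HB.mixin Record Vector_isLieAlgebra (K : fieldType) L of Vector K L := {
  lie : L -> L -> L;
  lie_linearl : forall y, linear (fun x => lie x y);
  lie_linearr : forall x, linear (lie x);
  liexx : forall x, lie x x = 0;
  lie_jacobi : forall x y z,
    lie x (lie y z) + lie y (lie z x) + lie z (lie x y) = 0
}.

#[short(type="lieAlgType")]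
HB.structure Definition LieAlgebra (K : fieldType) :=
  {L of Vector_isLieAlgebra K L & Vector K L}.

Section LieAlgebra.
Variables (K : fieldType) (L : lieAlgType K).
Implicit Types (x y z : L) (U I : {vspace L}) (f : 'End(L)).

Lemma lieDl x y z : lie (x + y) z = lie x z + lie y z.
Proof. by have := lie_linearl z 1 x y; rewrite !scale1r. Qed.
Lemma lieDr x y z : lie x (y + z) = lie x y + lie x z.
Proof. by have := lie_linearr x 1 y z; rewrite !scale1r. Qed.
Lemma lie0l x : lie 0 x = 0.
Proof. by apply: (@addrI _ (lie 0 x)); rewrite -lieDl !addr0. Qed.
Lemma lie0r x : lie x 0 = 0.
Proof. by apply: (@addrI _ (lie x 0)); rewrite -lieDr !addr0. Qed.
Lemma lieZl a x y : lie (a *: x) y = a *: lie x y.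
Proof. by have := lie_linearl y a x 0; rewrite lie0l !addr0. Qed.
Lemma lieZr a x y : lie x (a *: y) = a *: lie x y.
Proof. by have := lie_linearr x a y 0; rewrite lie0r !addr0. Qed.
Lemma lieNl x y : lie (- x) y = - lie x y.
Proof. by rewrite -scaleN1r lieZl scaleN1r. Qed.
Lemma lieNr x y : lie x (- y) = - lie x y.
Proof. by rewrite -scaleN1r lieZr scaleN1r. Qed.

Lemma lieC x y : lie x y = - lie y x.
Proof.
apply/eqP; rewrite -addr_eq0.
by have := liexx (x + y); rewrite lieDl !lieDr !liexx add0r addr0 => ->.
Qed.

Definition ad x : 'End(L) := linfun (lie x).

HB.instance Definition _ x :=
  GRing.isLinear.Build K L L *:%R (lie x) (lie_linearr x).

Lemma adE x y : ad x y = lie x y.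
Proof. by rewrite /ad lfunE. Qed.

Definition killing x y : K :=
  \tr (passmx.mxof (vbasis fullv) (vbasis fullv) (ad x \o ad y)%VF).

Definition ideal I := forall x y, y \in I -> lie x y \in I.

Definition simple_lie :=
  (exists x y, lie x y <> 0) /\
  (forall I, ideal I -> I = 0%VS \/ I = fullv).

Definition abelian_subspace U := {in U &, forall x y, lie x y = 0}.

Definition maximal_abelian U :=
  abelian_subspace U /\
  forall V : {vspace L}, abelian_subspace V -> (U <= V)%VS -> V = U.

Definition lie_center U x := x \in U /\ {in U, forall y, lie x y = 0}.

Definition lie_automorphism f :=
  bijective f /\ forall x y, f (lie x y) = lie (f x) (f y).

Definition lie_involution f :=
  [/\ lie_automorphism f, (f \o f)%VF = \1%VF & f <> \1%VF].

End LieAlgebra.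

Definition cplx (R : rcfType) (V : vectType R) : Type := (V * V)%type.

Section Complexification.
Variables (R : rcfType) (V : vectType R).

HB.instance Definition _ := GRing.Zmodule.on (cplx V).

Definition cscale (a : R[i]) (z : cplx V) : cplx V :=
  (complex.Re a *: z.1 - complex.Im a *: z.2,
   complex.Re a *: z.2 + complex.Im a *: z.1).


Let cscaleA a b z : cscale a (cscale b z) = cscale (a * b) z.
Proof.
case: a b z => [a a'] [b b'] [x y]; rewrite /cscale /=.
rewrite !(scalerBr, scalerDr, scalerBl, scalerDl) !scalerA !opprD.
by congr (_, _); rewrite [LHS](AC (2*2) ((1*4)*(2*3))).
Qed.

Let cscale1 : left_id 1 cscale.
Proof. by case=> x y; rewrite /cscale /= !scale1r !scale0r subr0 addr0. Qed.

Let cscaleDr : right_distributive cscale +%R.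
Proof.
case=> a a' [x y] [u v]; rewrite /cscale /= !scalerDr opprD.
by congr (_, _); rewrite addrACA.
Qed.

Let cscaleDl z : {morph cscale^~ z : a b / a + b}.
Proof.
case: z => x y [a a'] [b b']; rewrite /cscale /= !scalerDl opprD.
by congr (_, _); rewrite addrACA.
Qed.

HB.instance Definition _ :=
  GRing.Zmodule_isLmodule.Build R[i] (cplx V) cscaleA cscale1 cscaleDr cscaleDl.

Let cplx_vect_iso : Vector.axiom (\dim {:V}) (cplx V).
Proof.
have vb := vbasisP {:V}; set e := vbasis _ in vb.
pose h (r : 'rV[R[i]]_(\dim {:V})) : cplx V :=
  (passmx.vecof e (map_mx (@complex.Re R) r),
   passmx.vecof e (map_mx (@complex.Im R) r)).
exists (fun z : cplx V => \row_j (coord e j z.1 +i* coord e j z.2)).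
  move=> [a a'] [x y] [u v]; apply/rowP => j; rewrite !mxE /=.
  rewrite !(linearD, linearB, linearZ) /=; congr (_ +i* _).
  by rewrite linearN mulrN.
exists h.
  case=> x y; rewrite /h /=; congr (_, _).
    rewrite -[RHS](passmx.rVofK vb); congr passmx.vecof.
    by apply/rowP => j; rewrite !mxE.
  rewrite -[RHS](passmx.rVofK vb); congr passmx.vecof.
  by apply/rowP => j; rewrite !mxE.
move=> r; apply/rowP => j; rewrite !mxE /= !(passmx.coord_vecof vb) !mxE.
by case: (r 0 j).
Qed.

HB.instance Definition _ := Lmodule_hasFinDim.Build R[i] (cplx V) cplx_vect_iso.

End Complexification.

Section ComplexLie.
Variables (R : rcfType) (L : lieAlgType R).

Definition cplx_lie (z w : cplx L) : cplx L :=
  (lie z.1 w.1 - lie z.2 w.2, lie z.1 w.2 + lie z.2 w.1).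

Let cplx_lie_linearl w : linear (cplx_lie^~ w).
Proof.
case: w => u v; move=> [a a'] [x y] [x' y']; rewrite /cplx_lie /=.
by congr (_, _) => /=; rewrite !(lieDl, lieNl, lieZl) !(scalerBr, scalerDr) ?opprD;
  rewrite [LHS](AC (3*3) ((1*4)*(5*2)*(3*6))).
Qed.

Let cplx_lie_linearr z : linear (cplx_lie z).
Proof.
case: z => x y; move=> [a a'] [u v] [u' v']; rewrite /cplx_lie /=.
by congr (_, _) => /=; rewrite !(lieDr, lieNr, lieZr) !(scalerBr, scalerDr) ?opprD;
  rewrite [LHS](AC (3*3) ((1*4)*(2*5)*(3*6))).
Qed.

Let cplx_liexx z : cplx_lie z z = 0.
Proof.
case: z => x y; rewrite /cplx_lie /= !liexx subrr.
by congr (_, _); rewrite lieC addNr.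
Qed.

Let cplx_lie_jacobi x y z :
  cplx_lie x (cplx_lie y z) + cplx_lie y (cplx_lie z x)
  + cplx_lie z (cplx_lie x y) = 0.
Proof.
case: x y z => [x x'] [y y'] [z z']; rewrite /cplx_lie /=.
congr (_, _) => /=; rewrite !(lieDr, lieNr) ?opprD.
  rewrite [LHS](AC ((2*2)*(2*2)*(2*2))
    ((1*5*9)*(2*8*11)*(3*6*12)*(4*7*10))) /= -!opprD.
  by rewrite !lie_jacobi oppr0 !addr0.
rewrite [LHS](AC ((2*2)*(2*2)*(2*2))
  ((1*6*11)*(2*7*9)*(3*5*10)*(4*8*12))) /= -!opprD.
by rewrite !lie_jacobi oppr0 !addr0.
Qed.

HB.instance Definition _ := Vector_isLieAlgebra.Build R[i] (cplx L)
  cplx_lie_linearl cplx_lie_linearr cplx_liexx cplx_lie_jacobi.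

End ComplexLie.

Section ComplexifiedMaps.
Variables (R : rcfType) (U V : vectType R).

Definition cplx_fun (f : U -> V) (z : cplx U) : cplx V := (f z.1, f z.2).

Lemma cplx_fun_linear (f : 'Hom(U, V)) : linear (cplx_fun f).
Proof.
move=> [a a'] [x y] [x' y'].
by congr (_, _) => /=; rewrite !(linearD, linearN, linearZ).
Qed.

HB.instance Definition _ (f : 'Hom(U, V)) :=
  GRing.isLinear.Build R[i] (cplx U) (cplx V) *:%R (cplx_fun f)
    (cplx_fun_linear f).

Definition cplx_hom (f : 'Hom(U, V)) : 'Hom(cplx U, cplx V) :=
  linfun (cplx_fun f).

Lemma cplx_homE f z : cplx_hom f z = (f z.1, f z.2).
Proof. by rewrite lfunE. Qed.

End ComplexifiedMaps.

Definition compact_simple (R : realType) (g : lieAlgType R) :=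
  simple_lie g /\ forall x : g, x != 0 -> killing x x < 0.

(* [s v] is the sum of the series of the [f^k v / k!]; convergence in the
   finite-dimensional space [V] is convergence of every linear functional. *)
Definition is_exponential (R : realType) (V : vectType R) (f s : 'End(V)) :=
  forall (phi : 'Hom(V, R^o)) (v : V),
    series (fun k => (phi (iter k f v) : R) / k`!%:R) @ \oo --> (phi (s v) : R).

Section Roots.
Variables (R : realType) (g : lieAlgType R) (t : {vspace g}).

Local Notation tC := (cplx (subvs_of t)).
Local Notation dual := 'Hom(tC, R[i]^o).

Definition tC_incl (h : tC) : cplx g := cplx_fun vsval h.

(* [s = Ad (exp Z)], where [Z] in [t_C] is required to lie in the real form
   [t], so that [Ad (exp Z) = exp (ad Z)] acts on [g]. *)
Definition Ad_exp (Z : tC) (s : 'End(g)) :=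
  exists2 X : subvs_of t, ((X, 0) : tC) = Z & is_exponential (ad (vsval X)) s.

Definition is_root (b : dual) :=
  b <> 0 /\
  exists2 x : cplx g, x <> 0 &
    forall h : tC, lie (tC_incl h) x = (b h : R[i]) *: x.

Definition simple_roots n (alpha : 'I_n -> dual) :=
  [/\ forall j, is_root (alpha j),
      free [seq alpha j | j <- enum 'I_n]
    & forall b, is_root b -> exists k : 'I_n -> nat,
        b = \sum_j alpha j *+ k j \/ b = - \sum_j alpha j *+ k j].

Definition highest_root n (alpha : 'I_n -> dual) (delta : dual) :=
  is_root delta /\
  forall b, is_root b ->
    exists k : 'I_n -> nat, delta - b = \sum_j alpha j *+ k j.

(* [c = 2 (a, b) / (b, b)] for the form on [t_C^*] induced by the Killing form
   of [g_C]: [ha], [hb] are the elements of [t_C] representing [a], [b]. *)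
Definition cartan_integer (a b : dual) (c : int) :=
  let B (h h' : tC) : R[i] := killing (tC_incl h) (tC_incl h') in
  exists ha hb : tC,
    [/\ forall h, a h = B ha h, forall h, b h = B hb h
      & c%:~R = 2%:R * B ha hb / B hb hb].

(* [a |-> a \o f^-1], for [f] a linear automorphism preserving [t]. *)
Definition root_act (f : 'End(g)) (a : dual) : dual :=
  (a \o cplx_hom (linfun (vsproj t) \o f^-1 \o linfun vsval))%VF.

Lemma root_actE f a (h : tC) :
  root_act f a h =
  a (vsproj t (f^-1%VF (vsval h.1)), vsproj t (f^-1%VF (vsval h.2))).
Proof. by rewrite comp_lfunE cplx_homE !comp_lfunE !lfunE. Qed.

(* The simple roots of the fixed point algebra: the extended Dynkin diagram,
   with [alpha_0 = - delta], with the node [i] deleted. *)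
Definition Pi_h n (alpha : 'I_n -> dual) (delta : dual) (i : 'I_n) : set dual :=
  [set - delta] `|` [set alpha j | j in [set j | j != i]].

(* [alpha_0, alpha_1, ..., alpha_n], where [alpha_1, ..., alpha_n] are the
   simple roots in the order given by [s]. *)
Definition extended_roots n (alpha : 'I_n -> dual) (delta : dual)
    (s : seq 'I_n) : seq dual :=
  - delta :: [seq alpha j | j <- s].

Definition dynkin_type (l : nat) (C : nat -> nat -> int) (a : seq dual) :=
  size a = l.+1 /\
  forall j k, (1 <= j <= l)%N -> (1 <= k <= l)%N -> cartan_integer a`_j a`_k (C j k).

End Roots.

(* Nodes are numbered from 1: the chain 1 - 3 - 4 - 5 - ... with 2 attached to 4. *)
Definition bond_E (j k : nat) : bool :=
  [|| (j, k) == (1, 3)%N, (j, k) == (2, 4)%N | (2 < j)%N && (k == j.+1)].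

Definition cartan_E (j k : nat) : int :=
  if j == k then 2 else if bond_E j k || bond_E k j then -1 else 0.

(* The chain 1 - 2 => 3 - 4 with 1, 2 long: row [j], column [k] is
   [2 (alpha_j, alpha_k) / (alpha_k, alpha_k)]. *)
Definition cartan_F4 (j k : nat) : int :=
  nth 0 (nth [::] [:: [::  2; -1;  0;  0];
                      [:: -1;  2; -2;  0];
                      [::  0; -1;  2; -1];
                      [::  0;  0; -1;  2]] j.-1) k.-1.

Section Types.
Variables (V : zmodType) (act : V -> V) (a : seq V).

Definition type_I :=
  [/\ act a`_1 = a`_6, act a`_2 = a`_2, act a`_3 = a`_5, act a`_4 = a`_4
    & act a`_7 = a`_0].

Definition beta_E7 : V :=
  a`_1 + a`_2 + a`_3 *+ 2 + a`_4 *+ 3 + a`_5 *+ 2 + a`_6.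

Definition type_II :=
  [/\ act a`_1 = a`_1, act a`_2 = a`_2, act a`_3 = a`_0
    & [/\ act a`_5 = a`_7, act a`_6 = a`_6 & act a`_4 = beta_E7]].

Definition type_III :=
  [/\ act a`_1 = a`_6, act a`_2 = a`_2, act a`_3 = a`_7, act a`_5 = a`_0
    & act a`_4 = beta_E7].

Definition type_IV :=
  [/\ act a`_1 = a`_1, act a`_2 = a`_0, act a`_4 = a`_8
    & [/\ act a`_5 = a`_7, act a`_6 = a`_6
        & act a`_3 = a`_1 + a`_2 *+ 2 + a`_3 *+ 3 + a`_4 *+ 4 + a`_5 *+ 3
                     + a`_6 *+ 2 + a`_7]].

Definition type_V :=
  [/\ act a`_1 = a`_1, act a`_2 = a`_5, act a`_3 = a`_3, act a`_4 = a`_4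
    & [/\ act a`_7 = a`_0, act a`_8 = a`_8
        & act a`_6 = a`_1 + a`_2 + a`_3 *+ 2 + a`_4 *+ 3 + a`_5 *+ 3
                     + a`_6 *+ 3 + a`_7 *+ 2 + a`_8]].

Definition type_VI :=
  [/\ act a`_1 = a`_1, act a`_2 = a`_0, act a`_4 = a`_4
    & act a`_3 = a`_1 + a`_2 *+ 2 + a`_3 *+ 3 + a`_4].

End Types.

(* Main.v *)
Require Import Defs.
From HB Require Import structures.
From mathcomp Require Import all_boot all_order all_algebra.
From mathcomp Require Import ring lra zify.
From mathcomp Require Import complex.
From mathcomp Require Import boolp classical_sets reals topology.
From mathcomp Require Import normedtype sequences trigo.

Set Implicit Arguments.
Unset Strict Implicit.
Unset Printing Implicit Defensive.

Import Order.TTheory GRing.Theory Num.Theory.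
Import numFieldNormedType.Exports.

Local Open Scope classical_set_scope.
Local Open Scope complex_scope.
Local Open Scope ring_scope.

(** Minus the Killing form of [g], written [Q], is an inner product, so every
    root takes imaginary values on [t] and is given by a vector of [t]
    ([root_rotation]); roots are then handled through these vectors. Each root
    carries an sl2-triple of the complexified algebra, and the weights of a
    finite-dimensional sl2-module are integers ([sl2_weight]). Hence Cartan
    integers are integers, and for roots [a] and [b] with negative (positive)
    [Q]-product [a + b] (respectively [a - b]) is 0 or a root ([root_pair]).
    Applied to the nodes [- delta, alpha_1, ..., alpha_n] of the extended
    diagram, this shows that distinct nodes have nonpositive products.

    The relation [- delta + \sum_j alpha_j *+ m j = 0] now says that the
    marks [1, m_1, ..., m_n] are harmonic on the extended diagram: twice the
    mark of a node is the sum of the marks of its neighbours, weighted by the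
    bonds. The diagram is connected because [Q] is positive definite. A
    harmonic function is concave along paths, so a path from the node of mark
    1 to a node of mark 4 must start with the marks 1, 2, 3, 4 and simple
    incoming bonds; this leaves little freedom ([chain_step]): the chain 1, 2,
    3, ... goes on, or it closes up into the extended diagram of F4 or E7
    (after 4) or of E8 (after 6). As there are finitely many nodes, one of the
    three diagrams occurs ([classification]).

    The involution permutes the nodes other than [alpha_i], preserves their
    Cartan integers, and sends [alpha_i] to a root. Since the harmonic
    relation gives [m_i = 4] times the image of [alpha_i] in terms of the
    other nodes, integrality of that image is a congruence modulo 4 on the
    marks ([mark_congruence]). A finite search through the involutive
    permutations with these properties leaves exactly the six listed ones
    ([symmetries_E7_4] and the lemmas after it), and the harmonic relation
    gives the image of [alpha_i]. The permutation is not trivial, because the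
    roots separate the points of [t] ([roots_separate]).

    Finally [sigma] is a rotation by 0 or [2 pi] in the planes of the root
    vectors of the nodes other than [alpha_i], so it fixes them
    ([fixed_rotation]); an element of the center of the fixed algebra
    therefore lies in [t] and is killed by these nodes, hence by all roots. *)

(** * Traces, eigenvectors and the Killing form *)

Section LinearAlgebra.

Lemma mxtrace_mxof (F : fieldType) (V : vectType F)
    (e e' : (\dim {:V}).-tuple V) (f : 'End(V)) :
  basis_of {:V} e -> basis_of {:V} e' ->
  \tr (passmx.mxof e e f) = \tr (passmx.mxof e' e' f).
Proof.
move=> eb e'b; rewrite -[f in LHS]comp_lfun1l (passmx.mxof_comp _ _ e'b) //.
by rewrite mxtrace_mulC -(passmx.mxof_comp _ _ eb) // comp_lfun1r.
Qed.

Lemma mxofP (F : fieldType) (V : vectType F) (e : (\dim {:V}).-tuple V) a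
    (f g : 'End(V)) :
  passmx.mxof e e (a *: f + g) = a *: passmx.mxof e e f + passmx.mxof e e g.
Proof. exact: (passmx.mxof_linear e e). Qed.

(** Infinitely many distinct eigenvalues would be roots of one characteristic
    polynomial. *)
Lemma eigenvectors_finite (F : fieldType) (V : vectType F) (f : 'End(V))
    (v : nat -> V) (l : nat -> F) :
  injective l -> (forall k, f (v k) = l k *: v k) -> exists k, v k = 0.
Proof.
move=> linj fv; have [//|/forallNP v0] := pselect (exists k, v k = 0).
have eb := vbasisP {:V}; set e := vbasis _ in eb.
set p := char_poly (passmx.mxof e e f).
have p0 : p != 0 by rewrite monic_neq0 // char_poly_monic.
have rt k : root p (l k).
  rewrite -eigenvalue_root_char; apply/eigenvalueP.
  exists (passmx.rVof e (v k)); last by rewrite passmx.rVof_eq0 //; apply/eqP.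
  by rewrite -passmx.rVof_app // fv; apply/rowP => j; rewrite !mxE linearZ.
have al : all (root p) [seq l k | k <- iota 0 (size p)].
  by apply/allP => x /mapP[k _ ->].
have := max_poly_roots p0 al.
by rewrite size_map size_iota ltnn map_inj_uniq // iota_uniq => /(_ isT).
Qed.

Lemma eigenvector_in (C : closedFieldType) (V : vectType C) (W : {vspace V})
    (f : 'End(V)) : W != 0%VS -> (f @: W <= W)%VS ->
  exists2 x, x \in W & x != 0 /\ exists a, f x = a *: x.
Proof.
move=> W0 fW; pose g : 'End(subvs_of W) := (linfun (vsproj W) \o f \o linfun
  vsval)%VF.
pose n : nat := \dim {: subvs_of W}.
have eb := vbasisP {: subvs_of W}; set e := vbasis _ in eb.
have n0 : n != 0 by rewrite /n dimvf /= dimv_eq0.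
have [a ra] : exists a, eigenvalue (passmx.mxof e e g) a.
  have /closed_rootP[a rAa] : size (char_poly (passmx.mxof e e g)) != 1%N.
    by rewrite size_char_poly eqSS.
  by exists a; rewrite eigenvalue_root_char.
have : passmx.leigenspace g a != 0%VS.
  by rewrite (passmx.leigenspaceE eb) passmx.vsof_eq0.
rewrite -subv0 => /subvPn[x]; rewrite memv_ker add_lfunE opp_lfunE scale_lfunE.
rewrite id_lfunE subr_eq0 memv0 => /eqP gx x0.
exists (val x); first exact: subvsP.
split; first by apply: contra x0 => /eqP x0; apply/eqP/val_inj; rewrite x0.
exists a; move: gx; rewrite /g !comp_lfunE !lfunE /= => /(congr1 vsval) /=.
rewrite vsprojK ?linearZ //; apply: (subvP fW); apply: memv_img; exact: subvsP.
Qed.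

(** By induction on the dimension of [W]: an eigenspace in [W] of a member of
    [P] that is not a scalar on [W] is smaller and stable under the commuting
    family. The family may be infinite. *)
Lemma common_eigenvector_in (C : closedFieldType) (V : vectType C)
    (P : set 'End(V)) (W : {vspace V}) :
  (forall f g, P f -> P g -> forall x, f (g x) = g (f x)) ->
  W != 0%VS -> (forall f, P f -> (f @: W <= W)%VS) ->
  exists2 x, x \in W & x != 0 /\ forall f, P f -> exists a, f x = a *: x.
Proof.
move=> com; have [k] := ubnP (\dim W); elim: k W => // k IH W dW W0 stab.
have [sc|/existsNP[f /not_implyP[Pf /forallNP nf]]] :=
  pselect (forall f, P f -> exists a, forall x, x \in W -> f x = a *: x).
  exists (vpick W); first exact: memv_pick.
  split; first by rewrite vpick0.
  by move=> f /sc[a fa]; exists a; rewrite fa ?memv_pick.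
have [x xW [x0 [a fx]]] := eigenvector_in W0 (stab f Pf).
pose W' := (W :&: lker (f - a *: \1%VF))%VS.
have memW' y : (y \in W') = (y \in W) && (f y == a *: y).
  by rewrite memv_cap memv_ker !lfunE /= opp_lfunE scale_lfunE id_lfunE
    subr_eq0.
have W'W : (W' <= W)%VS by exact: capvSl.
have dW' : (\dim W' < k)%N.
  rewrite -ltnS; apply: leq_trans dW; rewrite ltnS ltnNge; apply/negP => le.
  have /eqP eW : W' == W by rewrite eqEdim W'W.
  by apply: (nf a) => y; rewrite -eW memW' => /andP[_ /eqP].
have [||y yW' [y0 Py]] := IH W' dW'.
- apply/eqP => W'0; have : x \in W' by rewrite memW' xW fx eqxx.
  by rewrite W'0 memv0 (negPf x0).
- move=> g Pg; apply/subvP => _ /memv_imgP[y yW' ->].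
  move: yW'; rewrite !memW' => /andP[yW /eqP fy].
  rewrite (subvP (stab g Pg)) ?memv_img //=.
  by rewrite com // fy linearZ.
by exists y; first exact: (subvP W'W).
Qed.

End LinearAlgebra.

Section LieGeneral.
Variables (K : fieldType) (L : lieAlgType K).
Implicit Types x y z : L.

Lemma lie_derivation x y z : lie x (lie y z) = lie (lie x y) z + lie y (lie x
  z).
Proof.
have /eqP := lie_jacobi x y z; rewrite -addrA addr_eq0 => /eqP ->.
by rewrite (lieC z x) lieNr (lieC z (lie x y)) opprD !opprK addrC.
Qed.

Lemma ad_lie x y : ad (lie x y) = (ad x \o ad y)%VF - (ad y \o ad x)%VF.
Proof.
apply/lfunP => z; rewrite add_lfunE opp_lfunE !comp_lfunE !adE.
by rewrite [in RHS]lie_derivation addrK.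
Qed.

Lemma killingE (e : (\dim {:L}).-tuple L) x y : basis_of {:L} e ->
  killing x y = \tr (passmx.mxof e e (ad x) *m passmx.mxof e e (ad y)).
Proof.
move=> eb; rewrite /killing (mxtrace_mxof _ (vbasisP _) eb).
by rewrite (passmx.mxof_comp _ _ eb) // mxtrace_mulC.
Qed.

Lemma killingC x y : killing x y = killing y x.
Proof. by rewrite !(killingE _ _ (vbasisP _)) mxtrace_mulC. Qed.

(** The trace identity [\tr ((XY - YX) Z) = \tr (X (YZ - ZY))]. *)
Lemma killing_inv x y z : killing (lie x y) z = killing x (lie y z).
Proof.
have eb := vbasisP {:L}; set e := vbasis _ in eb.
rewrite !(killingE _ _ eb) !ad_lie -!scaleN1r ![_ + -1 *: _]addrC !mxofP.
rewrite !(passmx.mxof_comp _ _ eb) !scaleN1r ![- _ + _]addrC.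
set A := passmx.mxof _ _ (ad x); set B := passmx.mxof _ _ _.
rewrite mulmxBl mulmxBr !linearB /=; congr (_ - _); last by rewrite mulmxA.
by rewrite mulmxA [RHS]mxtrace_mulC mulmxA.
Qed.

Lemma ad_linear : linear (@ad K L).
Proof.
move=> a x y; apply/lfunP => z.
by rewrite add_lfunE scale_lfunE !adE lieDl lieZl.
Qed.

Lemma killing_linear y : linear (killing y : L -> K^o).
Proof.
move=> a u v; rewrite !(killingE _ _ (vbasisP _)) ad_linear mxofP mulmxDr.
by rewrite -scalemxAr linearD linearZ.
Qed.

(** By the Jacobi identity weights add up. *)
Lemma lie_weight (h e x : L) (a b : K) :
  lie h e = a *: e -> lie h x = b *: x -> lie h (lie e x) = (b + a) *: lie e x.
Proof.
by move=> he hx; rewrite lie_derivation he hx lieZl lieZr -scalerDl addrC.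
Qed.

Lemma killing_involution (f : 'End(L)) x y : lie_involution f ->
  killing (f x) (f y) = killing x y.
Proof.
case=> -[_ fM] ff _; have fK z : f (f z) = z by rewrite -comp_lfunE ff id_lfunE.
have adf z : ad (f z) = (f \o ad z \o f)%VF.
  by apply/lfunP => w; rewrite !comp_lfunE !adE fM fK.
have eb := vbasisP {:L}; set e := vbasis _ in eb.
have /(congr1 (passmx.mxof e e)) := ff.
rewrite (passmx.mxof_comp _ _ eb) passmx.mxof1 ?(basis_free eb) // => FF.
rewrite !(killingE _ _ eb) !adf !(passmx.mxof_comp _ _ eb).
rewrite -!mulmxA (mulmxA (passmx.mxof e e f) (passmx.mxof e e f)) FF mul1mx.
by rewrite mxtrace_mulC -!mulmxA FF mulmx1.
Qed.

End LieGeneral.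

(** * Weights of sl2-modules *)

Section Sl2.
Variables (K : numFieldType) (L : lieAlgType K).
Implicit Types (e f h v : L).

Definition sl2_triple e f h :=
  [/\ lie e f = h, lie h e = 2 *: e & lie h f = - 2 *: f].

Lemma sl2_triple_swap e f h : sl2_triple e f h -> sl2_triple f e (- h).
Proof.
case=> ef he hf; split; first by rewrite lieC ef.
  by rewrite lieNl hf scaleNr opprK.
by rewrite lieNl he scaleNr.
Qed.

Lemma iter_weight h e v (a b : K) k :
  lie h e = a *: e -> lie h v = b *: v ->
  lie h (iter k (lie e) v) = (b + k%:R * a) *: iter k (lie e) v.
Proof.
move=> he hv; elim: k => [|k IH] /=; first by rewrite mul0r addr0.
by rewrite (lie_weight he IH) -addrA -natr1 mulrDl mul1r.
Qed.

(** The weights along a string are pairwise distinct, so the string stops. *)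
Lemma string_end h e v (a b : K) :
  a != 0 -> lie h e = a *: e -> lie h v = b *: v -> v != 0 ->
  exists k, iter k (lie e) v != 0 /\ lie e (iter k (lie e) v) = 0.
Proof.
move=> a0 he hv v0; pose l (k : nat) := b + k%:R * a.
have linj : injective l.
  by move=> j k /addrI /(mulIf a0) /eqP; rewrite eqr_nat => /eqP.
have [k] : exists k, iter k (lie e) v = 0.
  apply: (eigenvectors_finite (f := ad h) linj) => k.
  by rewrite adE; apply: iter_weight.
elim: k => [/= v00|k IH]; first by rewrite v00 eqxx in v0.
have [/IH //|n0] := eqVneq (iter k (lie e) v) 0.
by exists k.
Qed.

(** The lowering string from a highest weight vector [v] ends at some [f^k v
    <> 0] with [f^(k+1) v = 0]; raising it once gives [0 = (k+1) (b - k) f^k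
    v]. *)
Lemma highest_weight e f h v (b : K) : sl2_triple e f h ->
  lie h v = b *: v -> v != 0 -> lie e v = 0 -> exists k : nat, b = k%:R.
Proof.
move=> [ef he hf] hv v0 ev.
have [|k [fk fk0]] := string_end _ hf hv v0.
  by rewrite oppr_eq0 pnatr_eq0.
have ek j : lie e (iter j.+1 (lie f) v) =
    (j.+1%:R * (b - j%:R)) *: iter j (lie f) v.
  elim: j => [|j IH].
    by rewrite /= lie_derivation ev lie0r addr0 ef hv mul1r subr0.
  rewrite iterS lie_derivation ef IH (iter_weight _ hf hv) lieZr -iterS
    -scalerDl.
  by congr (_ *: _); rewrite -!natr1; ring.
exists k; have /eqP := ek k; rewrite iterS fk0 lie0r eq_sym scaler_eq0.
by rewrite (negPf fk) orbF mulf_eq0 pnatr_eq0 /= subr_eq0 => /eqP.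
Qed.

(** Raising [v] up to a highest weight vector shifts the weight by an even
    integer. The two sign statements say that a vector killed by [e] has
    weight at least 0, and one killed by [f] weight at most 0. *)
Lemma sl2_weight e f h v (b : K) : sl2_triple e f h ->
  lie h v = b *: v -> v != 0 ->
  exists c : int,
    [/\ b = c%:~R, c < 0 -> lie e v <> 0 & 0 < c -> lie f v <> 0].
Proof.
move=> s hv v0; have [ef he hf] := s.
have [|k [ek ek0]] := string_end _ he hv v0; first by rewrite pnatr_eq0.
have [l lE] := highest_weight s (iter_weight k he hv) ek ek0.
exists (l%:Z - (k * 2)%N%:Z).
have bE : b = (l%:Z - (k * 2)%N%:Z)%:~R.
  by rewrite rmorphB /= -!pmulrn -lE natrM; ring.
split=> //; move=> sgn ev.
  have [n nE] := highest_weight s hv v0 ev.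
  move: sgn; rewrite -(ltrz0 K) -bE nE; by rewrite ltrn0.
have [|n nE] := highest_weight (b := - b) (sl2_triple_swap s) _ v0 ev.
  by rewrite lieNl hv scaleNr.
move: sgn; rewrite -(ltr0z K) -bE -oppr_lt0 nE; by rewrite ltrn0.
Qed.

End Sl2.

(** * The Killing form of the complexification and of the compact form *)

Section KillingBasis.

Lemma killing_coord (K : fieldType) (L : lieAlgType K) n (E : n.-tuple L)
    (x y : L) : basis_of {:L} E ->
  killing x y = \sum_(i < n) coord E i (lie x (lie y E`_i)).
Proof.
move=> Eb; have nE : n = \dim {:L} by rewrite -(size_basis Eb).
subst n; rewrite /killing (mxtrace_mxof _ (vbasisP _) Eb) /mxtrace.
apply: eq_bigr => i _; rewrite !mxE /= passmx.vecof_delta.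
by rewrite comp_lfunE !adE.
Qed.

Variables (R : rcfType) (g : lieAlgType R).

(** A real basis is a complex basis of the complexification, which makes the
    Killing form of the complexification extend the real one. *)
Lemma cplx_basis (e : (\dim {:g}).-tuple g) : basis_of {:g} e ->
  let E := [tuple of [seq ((x, 0) : cplx g) | x <- e]] in
  basis_of {: cplx g} E /\
  forall i z, coord E i z = coord e i z.1 +i* coord e i z.2.
Proof.
move=> eb E.
have En (i : 'I_(\dim {:g})) : E`_i = (e`_i, 0).
  by rewrite (nth_map 0) ?size_tuple.
have decomp z : z = \sum_i (coord e i z.1 +i* coord e i z.2) *: E`_i.
  case: z => z1 z2; rewrite [LHS]surjective_pairing /=.
  rewrite {1}(coord_basis eb (memvf z1)) {1}(coord_basis eb (memvf z2)).
  rewrite [RHS]surjective_pairing; congr (_, _).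
    rewrite (big_morph (fun z : cplx g => z.1) (id1 := 0) (op1 := +%R)) //.
    by apply: eq_bigr => i _; rewrite En /= scaler0 subr0.
  rewrite (big_morph (fun z : cplx g => z.2) (id1 := 0) (op1 := +%R)) //.
  by apply: eq_bigr => i _; rewrite En /= scaler0 add0r.
have Eb : basis_of {: cplx g} E.
  rewrite basisEdim size_tuple; apply/andP; split.
    apply/subvP => z _; rewrite [z]decomp; apply: memv_suml => i _.
    by apply: memvZ; apply: memv_span; rewrite mem_nth ?size_tuple.
  by rewrite [leqRHS]dimvf.
split=> // i z; rewrite [z in LHS]decomp coord_sum_free //.
exact: basis_free Eb.
Qed.

Lemma killing_cplx (x y : g) :
  killing ((x, 0) : cplx g) ((y, 0) : cplx g) = (killing x y)%:C.
Proof.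
have eb := vbasisP {:g}; have [Eb cE] := cplx_basis eb.
rewrite (killing_coord _ _ Eb) (killing_coord _ _ eb).
rewrite (rmorph_sum (real_complex R)); apply: eq_bigr => i _ /=.
rewrite cE (nth_map 0) ?size_tuple //=.
by rewrite !(lie0l, lie0r, subr0, addr0) linear0.
Qed.

End KillingBasis.

(** The inner product of the compact form. It is locked because otherwise
    rewriting with [opprK] matches through its definition. *)
HB.lock Definition Q (R : realType) (g : lieAlgType R) (x y : g) : R :=
  - killing x y.

Section CompactForm.
Variables (R : realType) (g : lieAlgType R).
Hypothesis hg : compact_simple g.
Implicit Types x y z : g.

Lemma Q_linear x : linear (Q x : g -> R^o).
Proof. by move=> a u v; rewrite unlock killing_linear opprD scalerN. Qed.
HB.instance Definition _ x :=
  GRing.isLinear.Build R g R^o *:%R (Q x) (Q_linear x).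

Lemma QC x y : Q x y = Q y x.
Proof. by rewrite unlock killingC. Qed.

Lemma Q_inv x y z : Q (lie x y) z = Q x (lie y z).
Proof. by rewrite unlock killing_inv. Qed.

Lemma Q_skew h x y : Q (lie h x) y = - Q x (lie h y).
Proof. by rewrite lieC QC raddfN /= QC Q_inv. Qed.

Lemma Q_gt0 x : x != 0 -> 0 < Q x x.
Proof. by case: hg => _ neg /neg; rewrite unlock oppr_gt0. Qed.

Lemma Q_eq0 x : Q x x = 0 -> x = 0.
Proof. by apply: contra_eq => /Q_gt0; rewrite lt0r => /andP[]. Qed.

Lemma QDr x y z : Q x (y + z) = Q x y + Q x z. Proof. exact: linearD. Qed.
Lemma QNr x y : Q x (- y) = - Q x y. Proof. exact: linearN. Qed.
Lemma QZr x a y : Q x (a *: y) = a * Q x y. Proof. exact: linearZ. Qed.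
Lemma QDl x y z : Q (y + z) x = Q y x + Q z x.
Proof. by rewrite !(QC _ x) QDr. Qed.
Lemma QNl x y : Q (- y) x = - Q y x. Proof. by rewrite !(QC _ x) QNr. Qed.
Lemma QZl x a y : Q (a *: y) x = a * Q y x. Proof. by rewrite !(QC _ x) QZr.
  Qed.
Lemma Q0r x : Q x 0 = 0. Proof. exact: linear0. Qed.
Lemma Q0l x : Q 0 x = 0. Proof. by rewrite QC Q0r. Qed.

End CompactForm.

(** * Roots as vectors of the maximal abelian subalgebra *)

Section Covectors.
Variables (R : realType) (g : lieAlgType R) (t : {vspace g}).
Hypotheses (hg : compact_simple g) (ht : maximal_abelian t).

Local Notation tC := (cplx (subvs_of t)).
Local Notation dual := 'Hom(tC, R[i]^o).
Implicit Types (a b : dual) (u v : g) (h : tC).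

(** Maximality of [t]: adding an element that commutes with [t] keeps it
    abelian. *)
Lemma mem_t x : (forall y, y \in t -> lie y x = 0) -> x \in t.
Proof.
move=> xt; case: ht => ab mx; have tx : (t <= t + <[x]>)%VS by exact: addvSl.
rewrite -(mx _ _ tx) ?(subvP (addvSr _ _)) ?memv_line //.
move=> _ _ /memv_addP[y yt [_ /vlineP[c ->] ->]]
  /memv_addP[z zt [_ /vlineP[d ->] ->]].
rewrite !(lieDl, lieDr, lieZl, lieZr) ab // liexx xt //.
by rewrite (lieC x) xt // oppr0 !scaler0 !addr0.
Qed.

Lemma Q_ge0 (x : g) : 0 <= Q x x.
Proof. by have [->|/(Q_gt0 hg)/ltW//] := eqVneq x 0; rewrite Q0l. Qed.

Lemma Q_skew0 (h x : g) : Q (lie h x) x = 0.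
Proof. have := Q_skew h x x; rewrite (QC x); lra. Qed.

(** On the real form [t] the functional [a] is [i Q(_, u)]; the formula is its
    complex-linear extension. *)
Definition covector a u :=
  u \in t /\
  forall h, (a h : R[i]) = (- Q (vsval h.2) u) +i* Q (vsval h.1) u.

Lemma covector_real a u (h : subvs_of t) :
  covector a u -> (a (h, 0) : R[i]) = 0 +i* Q (vsval h) u.
Proof. by case=> _ -> /=; rewrite Q0l oppr0. Qed.

Lemma tC_eval a h : (a h : R[i]) = a (h.1, 0) + (0 +i* 1) * a (h.2, 0).
Proof.
have -> : h = ((h.1, 0) : tC) + (0 +i* 1 : R[i]) *: ((h.2, 0) : tC).
  case: h => h1 h2; congr (_, _) => /=;
  by rewrite !(scale0r, scaler0, scale1r, subr0, addr0, add0r).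
rewrite linearD linearZ /=; congr (a (_, _) + _ * a (_, _));
by rewrite /= !(scale0r, scaler0, scale1r, subr0, addr0, add0r).
Qed.

Lemma covectorP a u : u \in t ->
  (forall h : subvs_of t, (a (h, 0) : R[i]) = 0 +i* Q (vsval h) u) ->
  covector a u.
Proof.
move=> ut au; split=> // h; rewrite tC_eval !au.
by apply/eqP; rewrite eq_complex /=; apply/andP; split; apply/eqP; ring.
Qed.

Lemma covectorD a b u v : covector a u -> covector b v ->
  covector (a + b) (u + v).
Proof.
move=> [ut au] [vt bv]; split=> [|h]; first exact: memvD.
by rewrite add_lfunE au bv !QDr opprD.
Qed.

Lemma covectorN a u : covector a u -> covector (- a) (- u).
Proof.
move=> [ut au]; split=> [|h]; first by rewrite memvN.
by rewrite opp_lfunE au !QNr.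
Qed.

Lemma covector0 : covector 0 0.
Proof. by split=> [|h]; rewrite ?mem0v // zero_lfunE !Q0r oppr0. Qed.

Lemma covectorMn a u n : covector a u -> covector (a *+ n) (u *+ n).
Proof.
move=> au; elim: n => [|n IH]; first exact: covector0.
by rewrite !mulrSr; apply: covectorD.
Qed.

Lemma covector_sum (I : Type) (r : seq I) (P : pred I) (a : I ->
  dual) (u : I -> g) :
  (forall j, covector (a j) (u j)) ->
  covector (\sum_(j <- r | P j) a j) (\sum_(j <- r | P j) u j).
Proof.
move=> au; elim/big_rec2: _ => [|j x y _ xy]; first exact: covector0.
exact: covectorD.
Qed.

Lemma covector_uniq a u v : covector a u -> covector a v -> u = v.
Proof.
move=> au av; have [ut _] := au; have [vt _] := av.
apply/eqP; rewrite -subr_eq0; apply/eqP/(Q_eq0 hg).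
have uvt : u - v \in t by rewrite memvB.
have := covector_real (vsproj t (u - v)) au.
rewrite (covector_real _ av) vsprojK // => -[].
by move=> E; rewrite QDr QNr E subrr.
Qed.

Lemma covector_inj a b u : covector a u -> covector b u -> a = b.
Proof.
move=> [_ au] [_ bu]; apply/lfunP => h.
by have := au h; rewrite -bu.
Qed.

(** The real picture of a root vector [x1 + i x2] of weight [i Q(_, u)]: [t]
    acts on the plane of [x1] and [x2] by infinitesimal rotations. *)
Definition rotation (u x1 x2 : g) :=
  [/\ x1 != 0, x2 != 0, lie x1 x2 = - Q x2 x2 *: u
    & forall y, y \in t -> lie y x1 = - Q y u *: x2 /\ lie y x2 = Q y u *: x1].

Lemma root_vectorP a (x : cplx g) h :
  lie (tC_incl h) x = (a h : R[i]) *: x <->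
  lie (vsval h.1) x.1 - lie (vsval h.2) x.2
    = complex.Re (a h : R[i]) *: x.1 - complex.Im (a h : R[i]) *: x.2 /\
  lie (vsval h.1) x.2 + lie (vsval h.2) x.1
    = complex.Re (a h : R[i]) *: x.2 + complex.Im (a h : R[i]) *: x.1.
Proof.
split=> [[e1 e2]|[e1 e2]]; first by [].
by congr (_, _).
Qed.

(** The operators [ad h] with [h] in [t] are skew for [Q], so [a (h, 0)] is
    imaginary, say [i b(h)], and [Q(h, [x1, x2]) = - b(h) Q(x2, x2)]. As [[x1,
    x2]] commutes with [t] it lies in [t], and its multiple [u] represents
    [b]. *)
Lemma root_rotation a : is_root a ->
  exists u x1 x2, [/\ covector a u, u != 0 & rotation u x1 x2].
Proof.
case=> a0 [[x1 x2] x0 /(_ _)/root_vectorP ax].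
pose b (h : subvs_of t) := complex.Im (a (h, 0) : R[i]).
have ah (h : subvs_of t) : (a (h, 0) : R[i]) = 0 +i* b h /\
    lie (vsval h) x1 = - b h *: x2 /\ lie (vsval h) x2 = b h *: x1.
  have /= [] := ax (h, 0); rewrite !lie0l subr0 addr0.
  rewrite /b; case: (a _) => p q /= e1 e2.
  (* The real part vanishes since [ad h] is skew and [Q] is definite. *)
  have p0 : p = 0.
    have f1 := Q_skew0 (vsval h) x1; have f2 := Q_skew0 (vsval h) x2.
    move: f1 f2; rewrite e1 e2 !(QDl, QNl, QZl) (QC x2 x1) => f1 f2.
    have : p * (Q x1 x1 + Q x2 x2) = 0 by rewrite -[RHS]addr0 -{1}f1 -f2; ring.
    move/eqP; rewrite mulf_eq0 => /orP[/eqP//|].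
    have := Q_ge0 x1; have := Q_ge0 x2; move=> p2 p1.
    rewrite paddr_eq0 // => /andP[/eqP/(Q_eq0 hg) z1 /eqP/(Q_eq0 hg) z2].
    by case: x0; rewrite z1 z2.
  by rewrite e1 e2 p0 !scale0r sub0r add0r scaleNr.
have [h0 bh0] : exists h0 : subvs_of t, b h0 <> 0.
  apply: contrapT => /forallNP nb; apply: a0; apply/lfunP => h.
  rewrite tC_eval zero_lfunE (ah h.1).1 (ah h.2).1.
  have -> := contrapT (nb h.1); have -> := contrapT (nb h.2).
  by rewrite mulr0 addr0.
(* The two halves of a root vector have equal norm. *)
have Q12 : Q x1 x1 = Q x2 x2.
  have := Q_skew (vsval h0) x1 x2; have [_ [-> ->]] := ah h0.
  rewrite QZl QZr mulNr => /oppr_inj /(mulfI _) -> //; exact/eqP.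
have x20 : x2 != 0.
  apply/eqP => x20; apply: x0; rewrite x20; congr (_, _).
  by apply: (Q_eq0 hg); rewrite Q12 x20 Q0l.
have Q2 : Q x2 x2 != 0 by rewrite gt_eqF ?Q_gt0.
have x10 : x1 != 0 by apply: contra_neq Q2 => x10; rewrite -Q12 x10 Q0l.
have au : covector a (- (Q x2 x2)^-1 *: lie x1 x2).
  apply: covectorP => [|h].
    apply/memvZ/mem_t => y yt; rewrite lie_derivation.
    have [_] := ah (vsproj t y); rewrite vsprojK // => -[-> ->].
    by rewrite lieZl lieZr !liexx !scaler0 addr0.
  have [-> [hx1 _]] := ah h.
  by rewrite QZr -Q_inv hx1 QZl; congr (_ +i* _); field.
exists (- (Q x2 x2)^-1 *: lie x1 x2), x1, x2; split=> //.
  apply/eqP => u0; case: bh0; have := ah h0; rewrite (covector_real h0 au) u0.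
  by rewrite Q0r => -[[]].
split=> //; first by rewrite scalerA mulrNN mulfV // scale1r.
move=> h ht'; have := ah (vsproj t h); rewrite (covector_real _ au) vsprojK //.
by case=> -[<-].
Qed.

End Covectors.

(** * Pairs of roots *)

Section RootPairs.
Variables (R : realType) (g : lieAlgType R) (t : {vspace g}).
Hypotheses (hg : compact_simple g) (ht : maximal_abelian t).

Local Notation tC := (cplx (subvs_of t)).
Local Notation dual := 'Hom(tC, R[i]^o).
Implicit Types (a b : dual) (u v : g) (h : tC).

Lemma cplx_lieE (z w : cplx g) :
  lie z w = (lie z.1 w.1 - lie z.2 w.2, lie z.1 w.2 + lie z.2 w.1).
Proof. by []. Qed.

Lemma cplx_scaleE (a : R[i]) (z : cplx g) :
  a *: z = (complex.Re a *: z.1 - complex.Im a *: z.2,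
            complex.Re a *: z.2 + complex.Im a *: z.1).
Proof. by []. Qed.

Definition weight_vector a (x : cplx g) :=
  forall h, lie (tC_incl h) x = (a h : R[i]) *: x.

Lemma rotation_weight a u x1 x2 : covector a u -> rotation t u x1 x2 ->
  weight_vector a (x1, x2) /\ weight_vector (- a) (x1, - x2).
Proof.
move=> [_ au] [_ _ _ rot].
split=> h; have [e1 e2] := rot _ (subvsP h.1);
  have [e3 e4] := rot _ (subvsP h.2).
  by apply/root_vectorP; rewrite au /= e1 e2 e3 e4 !scaleNr; split;
    rewrite addrC.
apply/root_vectorP; rewrite opp_lfunE au /= !lieNr e1 e2 e3 e4.
by rewrite !(scaleNr, scalerN, opprK); split; rewrite addrC.
Qed.

Lemma weight_lie a b (x y : cplx g) : weight_vector a x -> weight_vector b y ->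
  weight_vector (a + b) (lie x y).
Proof. by move=> ax bY h; rewrite (lie_weight (ax h) (bY h)) add_lfunE addrC.
  Qed.

Lemma is_rootN a : is_root a -> is_root (- a).
Proof.
move=> ra; have [a0 _] := ra;
  have [u [x1 [x2 [au u0 rot]]]] := root_rotation hg ht ra.
split; first by move/eqP; rewrite oppr_eq0 => /eqP.
exists (x1, - x2); last exact: (rotation_weight au rot).2.
by case: rot => /eqP x10 _ _ _ [].
Qed.

Lemma root_covector a : is_root a -> exists u, covector a u.
Proof. by move=> /(root_rotation hg ht)[u [_ [_ [au _ _]]]]; exists u. Qed.

Lemma covector_neq0 a u : is_root a -> covector a u -> u != 0.
Proof.
move=> ra au; have [v [_ [_ [av v0 _]]]] := root_rotation hg ht ra.
by rewrite (covector_uniq hg au av).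
Qed.

(** The triple consists of a root vector, a multiple of its complex conjugate,
    and their bracket; the latter is the coroot, since [[y1, y2]] is a
    multiple of [v]. *)
Lemma root_sl2 b v : is_root b -> covector b v -> exists e f : cplx g,
  [/\ sl2_triple e f (0, - (2 / Q v v) *: v), weight_vector b e
    & weight_vector (- b) f].
Proof.
move=> rb bv; have [v' [y1 [y2 [bv' v0 rot]]]] := root_rotation hg ht rb.
rewrite -{v' bv'}(covector_uniq hg bv bv') in v0 rot *.
have [we wf] := rotation_weight bv rot; have [_ y20 y12 _] := rot.
have q0 : Q y2 y2 != 0 by rewrite gt_eqF ?Q_gt0.
have v1 : Q v v != 0 by rewrite gt_eqF ?Q_gt0.
pose c : R[i] := (- (Q y2 y2 * Q v v)^-1)%:C.
exists (y1, y2), (c *: ((y1, - y2) : cplx g)); split=> //; last first.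
  by move=> h; rewrite lieZr wf !scalerA mulrC.
have bH : (b (0, - (2 / Q v v) *: vsproj t v) : R[i]) = 2.
  case: (bv) => vt -> /=; rewrite vsprojK // Q0l.
  by rewrite QZl -[RHS](rmorph_nat (real_complex R) 2); congr (_ +i* _); field.
have vt : v \in t by case: bv.
have iH : tC_incl ((0, - (2 / Q v v) *: vsproj t v) : tC) = (0,
  - (2 / Q v v) *: v).
  by congr (_, _); rewrite /= vsprojK.
split.
- rewrite lieZr cplx_lieE cplx_scaleE /= !lieNr !liexx (lieC y2) y12.
  rewrite !(scale0r, subr0, addr0, oppr0, scaler0, scaleNr,
    opprK). rewrite -scalerDl.
  congr (_, _); rewrite scalerA -[LHS]scaleNr -[RHS]scaleNr; congr (_ *: _).
  by field; apply/andP.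
- by rewrite -iH we bH.
by rewrite -iH lieZr wf opp_lfunE bH scalerA mulrC -scalerA.
Qed.

(** A root vector of [a] is a weight vector for the triple of [b]; its weight
    is the Cartan integer, and its sign tells which of [e], [f] moves it to
    another root space. *)
Lemma root_pair a b u v :
  is_root a -> is_root b -> covector a u -> covector b v ->
  exists c : int, [/\ 2 * Q u v / Q v v = c%:~R,
    c < 0 -> a + b <> 0 -> is_root (a + b)
  & 0 < c -> a - b <> 0 -> is_root (a - b)].
Proof.
move=> [_ [x x0 ax]] rb au bv; have [e [f [s we wf]]] := root_sl2 rb bv.
have hx : lie ((0, - (2 / Q v v) *: v) : cplx g) x = (2 * Q u v / Q v v)%:C *:
  x.
  have vt : v \in t by case: bv.
  have := ax (0, - (2 / Q v v) *: vsproj t v).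
  rewrite /tC_incl /cplx_fun /= vsprojK // => ->; congr (_ *: _).
  case: au => _ -> /=; rewrite vsprojK // Q0l QZl (QC v); congr (_ +i* _); ring.
have [|c [cE ce cf]] := sl2_weight s hx; first exact/eqP.
exists c; split.
- by apply: (fmorph_inj (real_complex R)); rewrite /= cE rmorph_int.
- move=> /ce ex ab0; split=> //; exists (lie e x) => // h.
  by rewrite (weight_lie we ax) addrC.
move=> /cf fx ab0; split=> //; exists (lie f x) => // h.
by rewrite (weight_lie wf ax) addrC.
Qed.

End RootPairs.

(** * Roots separate the points of the maximal abelian subalgebra *)

Section RootsSeparate.
Variables (R : realType) (g : lieAlgType R) (t : {vspace g}).
Hypotheses (hg : compact_simple g) (ht : maximal_abelian t).

Local Notation tC := (cplx (subvs_of t)).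
Local Notation dual := 'Hom(tC, R[i]^o).

Lemma ad_eq0 (x : g) : (forall y, lie x y = 0) -> x = 0.
Proof.
move=> x0; apply: (Q_eq0 hg); rewrite unlock (killing_coord _ _ (vbasisP _)).
by rewrite big1 ?oppr0 // => i _; rewrite x0 linear0.
Qed.

Lemma ad_sq_eq0 (h u : g) : lie h (lie h u) = 0 -> lie h u = 0.
Proof. by move=> h2; apply: (Q_eq0 hg); rewrite Q_skew h2 Q0r oppr0. Qed.

Lemma tC_incl_linear : linear (tC_incl (t := t)).
Proof. by move=> [p q] [x x'] [y y']. Qed.

(** The eigenvalue is a coordinate of the bracket divided by the same
    coordinate of [w], which is linear in the element of [t]. *)
Lemma common_eigenvector_weight (w : cplx g) : w != 0 ->
  (forall y, y \in t -> exists c : R[i], lie ((y, 0) : cplx g) w = c *: w) ->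
  exists a : dual, weight_vector a w.
Proof.
move=> w0 wt.
have eb := vbasisP {: cplx g}; set e := vbasis _ in eb.
have [j cj] : exists j, coord e j w != 0.
  apply: contrapT => /forallNP nc; case/eqP: w0.
  rewrite (coord_basis eb (memvf w)) big1 // => j _.
  by have /negP := nc j; rewrite negbK => /eqP ->; rewrite scale0r.
pose f (h : tC) : R[i]^o := coord e j (lie (tC_incl h) w) / coord e j w.
have fl : linear f.
  move=> c x y; rewrite /f tC_incl_linear lieDl lieZl linearP mulrDl.
  by rewrite -mulrA.
pose F := GRing.isLinear.Build _ _ _ _ f fl.
pose fL : {linear tC -> R[i]^o} := HB.pack f F.
exists (linfun fL) => h; rewrite lfunE /= /f.
have [c ->] : exists c : R[i], lie (tC_incl h) w = c *: w.
  have [c1 e1] := wt _ (subvsP h.1); have [c2 e2] := wt _ (subvsP h.2).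
  exists (c1 + (0 +i* 1) * c2); rewrite scalerDl -scalerA -e1 -e2 -lieZl -lieDl.
  congr (lie _ _); congr (_, _) => /=;
  by rewrite !(scale0r, scale1r, scaler0, addr0, add0r, subr0, subrr, oppr0).
by rewrite linearZ /= mulfK.
Qed.

(** If [x] is not 0 then [ad x] is not 0, and its image contains a common
    eigenvector [w] of [t]. The eigenvalue of [x] on [w] is not 0: a skew
    operator has trivial kernel on its image. *)
Lemma roots_separate (x : subvs_of t) :
  (forall a : dual, is_root a -> (a (x, 0) : R[i]) = 0) -> x = 0.
Proof.
move=> ax; apply: contrapT => x0; set h := vsval x.
have h0 : h <> 0 by move=> h0; apply: x0; apply: val_inj; exact: h0.
have ht' : h \in t by exact: subvsP.
pose H := ad ((h, 0) : cplx g).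
pose P := [set f | exists2 y, y \in t & f = ad ((y, 0) : cplx g)].
have commt y z : y \in t -> z \in t ->
    lie ((y, 0) : cplx g) ((z, 0) : cplx g) = 0.
  case: ht => ab _ yt zt.
  by rewrite cplx_lieE /= !(lie0l, lie0r) ab // subr0 addr0.
have commP y z (w : cplx g) : y \in t -> z \in t ->
    lie ((y, 0) : cplx g) (lie ((z, 0) : cplx g) w)
    = lie ((z, 0) : cplx g) (lie ((y, 0) : cplx g) w).
  by move=> yt zt; rewrite lie_derivation commt // lie0l add0r.
have HE y : H y = (lie h y.1, lie h y.2).
  by rewrite adE cplx_lieE /= !lie0l subr0 addr0.
have [w wW [w0 wt]] : exists2 w, w \in limg H &
    w != 0 /\ forall f, P f -> exists a : R[i], f w = a *: w.
  apply: common_eigenvector_in.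
  - by move=> _ _ [y yt ->] [z zt ->] w; rewrite !adE commP.
  - apply/eqP => W0; apply: h0; apply: ad_eq0 => y.
    have : H (y, 0) \in limg H by rewrite memv_img ?memvf.
    by rewrite W0 memv0 HE => /eqP[].
  move=> _ [y yt ->]; apply/subvP => _ /memv_imgP[_ /memv_imgP[z _ ->] ->].
  by rewrite !adE commP // -(adE ((h, 0) : cplx g)) memv_img ?memvf.
have [|a wa] := common_eigenvector_weight w0.
  by move=> y yt; have [|c] := wt (ad ((y, 0) : cplx g));
    [exists y|rewrite adE; exists c].
have Hw : H w = (a (x, 0) : R[i]) *: w by rewrite adE -wa.
have a0 : (a (x, 0) : R[i]) != 0.
  apply/eqP => a0; move: Hw; rewrite a0 scale0r HE.
  move: w0; have /memv_imgP[u _ ->] := wW; rewrite HE /=.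
  by move=> /eqP w0 [] /ad_sq_eq0 e1 /ad_sq_eq0 e2; apply: w0; rewrite e1 e2.
have ra : is_root a.
  split; last by exists w => //; apply/eqP.
  by move=> a00; move: a0; rewrite a00 zero_lfunE eqxx.
by have /eqP := ax a ra; rewrite (negPf a0).
Qed.

Lemma covectors_separate (x : g) : x \in t ->
  (forall (a : dual) u, is_root a -> covector a u -> Q x u = 0) -> x = 0.
Proof.
move=> xt xu; suff : vsproj t x = 0 by move/(congr1 vsval); rewrite /= vsprojK.
apply: roots_separate => a ra; have [u au] := root_covector hg ht ra.
by rewrite (covector_real _ au) vsprojK // (xu a).
Qed.

End RootsSeparate.

(** * The exponential of a rotation *)

Section ExpRotation.
Variables (R : realType) (V : vectType R).

(** The coefficients are those of the cosine and sine series, up to the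
    factorial. *)
Lemma iter_rotation (f : 'End(V)) (x1 x2 : V) (th : R) k :
  f x1 = - th *: x2 -> f x2 = th *: x1 ->
  iter k f x1 = ((~~ odd k)%:R * (-1) ^+ k./2 * th ^+ k) *: x1
              - ((odd k)%:R * (-1) ^+ k.-1./2 * th ^+ k) *: x2.
Proof.
move=> f1 f2; elim: k => [|k IH];
  first by rewrite /= !mul0r scale0r !mulr1 scale1r subr0.
rewrite iterS IH linearB !linearZ /= f1 f2 !scalerA addrC exprS.
case: (boolP (odd k)) => ok /=; last first.
  rewrite !mul0r !scale0r !add0r scalerN -scaleNr.
  by congr (_ *: _); ring.
have -> : uphalf k = k.-1./2.+1.
  by case: k ok {IH} => // k; rewrite /= => /negPf; rewrite uphalf_half => ->.
rewrite !mul0r !scale0r !addr0 scalerN scalerA -scaleNr exprS.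
by congr (_ *: _); ring.
Qed.

Lemma exp_rotation (f s : 'End(V)) (x1 x2 : V) (th : R) :
  is_exponential f s -> f x1 = - th *: x2 -> f x2 = th *: x1 ->
  s x1 = cos th *: x1 - sin th *: x2.
Proof.
move=> fs f1 f2; have eb := vbasisP {:V}; set e := vbasis _ in eb.
rewrite (coord_basis eb (memvf (s x1))) [RHS](coord_basis eb (memvf _)).
apply: eq_bigr => i _; congr (_ *: _).
pose phi : 'Hom(V, R^o) := linfun (coord e i).
have := fs phi x1; rewrite lfunE /= => lim1.
have lim2 : series (fun k => (phi (iter k f x1) : R) / k`!%:R) @ \oo -->
    (phi x1 : R) * cos th - (phi x2 : R) * sin th.
  rewrite cos.unlock sin.unlock.
  have -> : series (fun k => (phi (iter k f x1) : R) / k`!%:R) =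
     (fun n => (phi x1 : R) * series (cos_coeff th) n
             - (phi x2 : R) * series (sin_coeff th) n).
    apply/funext => n; rewrite /series /= !mulr_sumr -sumrB.
    apply: eq_bigr => k _; rewrite (iter_rotation k f1 f2) linearB !linearZ /=.
    rewrite /cos_coeff /sin_coeff /= -![(_ : R) *: (_ : R^o)]/(_ * _) -exprnP.
      ring.
  apply: cvgB; apply: cvgMr; [exact: is_cvg_series_cos_coeff|exact:
    is_cvg_series_sin_coeff].
rewrite (cvg_unique _ lim1 lim2) // /phi !lfunE /= linearB !linearZ /=.
by rewrite -![(_ : R) *: (_ : R^o)]/(_ * _); ring.
Qed.

End ExpRotation.

(** * Diagrams with harmonic marks *)

(** [A j k] is the absolute value of the Cartan integer of the nodes [j] and
    [k]. Connectedness is used through closed sets of nodes, the form in which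
    positive definiteness provides it. *)
Section MarkedDiagrams.
Variables (T : finType) (A : T -> T -> nat) (m : T -> nat) (x0 : T).
Hypothesis m_gt0 : forall k, (0 < m k)%N.
Hypothesis A_eq0 : forall j k, A j k = 0%N -> A k j = 0%N.
Hypothesis harmonic : forall k, (\sum_(j | j != k) m j * A j k = 2 * m k)%N.
Hypothesis connected : forall S : {set T}, x0 \in S ->
  (forall j k, k \in S -> j \notin S -> A j k = 0%N) -> forall k, k \in S.
Hypothesis m_x0 : m x0 = 1%N.

Definition wsum k (s : seq T) := sumn [seq (m j * A j k)%N | j <- s].

Lemma wsumE k s : uniq (k :: s) ->
  (wsum k s + \sum_(j | j \notin k :: s) m j * A j k = 2 * m k)%N.
Proof.
move=> /= /andP[ks us]; rewrite -(harmonic k) [RHS](bigID (mem s)) /=;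
  congr (_ + _)%N.
  rewrite /wsum sumnE big_map big_uniq //=; apply: eq_bigl => j.
  by case: (boolP (j \in s)) => js; rewrite ?andbF // andbT; apply/esym;
    apply: contraNneq ks => <-.
by apply: eq_bigl => j; rewrite inE negb_or.
Qed.

Lemma wsum_le k s : uniq (k :: s) -> (wsum k s <= 2 * m k)%N.
Proof. by move=> /wsumE <-; rewrite leq_addr. Qed.

(** Once the neighbours found at [k] use up its harmonic sum, there are no
    others. *)
Lemma saturated k s j : uniq (k :: s) -> wsum k s = (2 * m k)%N ->
  j \notin k :: s -> A j k = 0%N.
Proof.
move=> us e js; have := wsumE us; rewrite e => /eqP.
rewrite -[X in _ == X]addn0 eqn_add2l sum_nat_eq0 => /forall_inP /(_ j js).
by rewrite muln_eq0 eqn0Ngt m_gt0 => /eqP.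
Qed.

(** While the harmonic sum is not used up, there is one more neighbour [j].
    The last bound is the harmonic sum at [j], which sees [k]; it keeps the
    mark of [j] from being too small. *)
Lemma new_neighbour k s : uniq (k :: s) -> (wsum k s < 2 * m k)%N ->
  exists j, [/\ j \notin k :: s, (0 < A j k)%N, (0 < A k j)%N,
    (wsum k (j :: s) <= 2 * m k)%N & (m k * A k j <= 2 * m j)%N].
Proof.
move=> us lt; have [j js aj] : exists2 j, j \notin k :: s & A j k != 0%N.
  apply: contrapT => nj; move: lt;
    rewrite -(wsumE us) big1 ?addn0 ?ltnn // => j js.
  by have [->|aj] := eqVneq (A j k) 0%N; [rewrite muln0|case: nj; exists j].
have akj : A k j != 0%N by apply: contra_neq aj => /A_eq0.
exists j; split; rewrite ?lt0n //.
  apply: wsum_le; move: js us => /=;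
    rewrite inE negb_or => /andP[jk ->] /andP[ks ->].
  by rewrite inE negb_or ks eq_sym jk.
have /wsum_le : uniq [:: j; k].
  by move: js; rewrite /= !inE negb_or => /andP[->].
by rewrite /wsum /= addn0.
Qed.

Definition adjacent : rel T := fun j k => (j != k) && (0 < A j k)%N.

Lemma adjacent_sym : symmetric adjacent.
Proof.
move=> j k; rewrite /adjacent eq_sym !lt0n; congr (_ && ~~ _).
by apply/eqP/eqP => /A_eq0.
Qed.

(** The harmonic sum at a node of mark [n], between a neighbour of mark [n.-1]
    and one of larger mark [y], has no room for anything else. *)
Lemma concave_mark n y a b : (0 < a)%N -> (0 < b)%N -> (n < y)%N ->
  (n.-1 * a + y * b <= 2 * n)%N -> [/\ y = n.+1, b = 1%N & (1 < n)%N ->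
    a = 1%N].
Proof.
move=> a0 b0 ny le; have b1 : b = 1%N by nia.
subst b; rewrite muln1 in le; have le1 := leq_pmulr n.-1 a0.
have ey : y = n.+1 by lia.
split=> // n1; have : (n.-1 * a <= n.-1 * 1)%N by lia.
rewrite leq_pmul2l; lia.
Qed.

Lemma path_to i : exists2 p,
  path adjacent x0 p & uniq (x0 :: p) /\ last x0 p = i.
Proof.
have : i \in [set k | connect adjacent x0 k]%SET.
  apply: connected => [|j k]; rewrite !inE ?connect0 // => ck nj.
  apply/eqP; apply: contraNT nj => ajk.
  have [-> //|njk] := eqVneq j k.
  apply: (connect_trans ck); apply: connect1.
  by rewrite adjacent_sym /adjacent njk lt0n.
rewrite inE => /connectP[p pp ->].
have [p' pp' up' _] := shortenP pp.
by exists p'.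
Qed.

(** Harmonic marks are concave along paths: [m(x) + m(z) <= 2 m(y)] if [y]
    lies between [x] and [z]. *)
Lemma path_nonincreasing x y p : adjacent x y -> path adjacent y p ->
  uniq [:: x, y & p] -> (m y <= m x)%N -> forall z, z \in p -> (m z <= m y)%N.
Proof.
elim: p x y => // z p IH x y xy /= /andP[yz pz] /and3P[].
rewrite !inE !negb_or => /and3P[nxy nxz xp] /andP[nyz yp] /andP[zp up] le.
have mz : (m z <= m y)%N.
  have /wsum_le : uniq [:: y; x;
    z] by rewrite /= !inE negb_or eq_sym nxy nyz nxz.
  rewrite /wsum /= addn0.
  move: xy yz; rewrite [adjacent y z]adjacent_sym /adjacent =>
    /andP[_ a1] /andP[_ a2].
  nia.
move=> w; rewrite inE => /orP[/eqP -> //|wp].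
apply: leq_trans (mz); apply: (IH y z) => //=.
by rewrite inE negb_or nyz yp zp.
Qed.

(** The simple bonds into the inner nodes use up their harmonic sums, so all
    the neighbours of [c 1, ..., c N.-1] lie on the chain ([chain_neighbour]).
    The bond into [c N] is left open. *)
Definition chain N (c : nat -> T) :=
  [/\ c 1%N = x0, forall k, (0 < k <= N)%N -> m (c k) = k,
      forall k, (0 < k < N)%N -> A (c k.+1) (c k) = 1%N /\
        ((1 < k)%N -> A (c k.-1) (c k) = 1%N)
    & (0 < A (c N.-1) (c N))%N].

Lemma chain_neq N c j k : chain N c -> (0 < j <= N)%N -> (0 < k <= N)%N ->
  (c j == c k) = (j == k).
Proof.
case=> _ mc _ _ jN kN; apply/eqP/eqP => [e|-> //].
by rewrite -(mc j jN) -(mc k kN) e.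
Qed.

Lemma chain_neighbour N c k j : chain N c -> (0 < k < N)%N -> j != c k ->
  (0 < A j (c k))%N -> j = c k.+1 \/ (1 < k)%N /\ j = c k.-1.
Proof.
move=> ch kN jk ajk; have cn := chain_neq ch; have [_ mc e _] := ch.
have [a1 a2] := e k kN.
have [->|j1] := eqVneq j (c k.+1); first by left.
have [k1|k1] := ltnP 1 k; last first.
  have {}k1 : k = 1%N by lia.
  subst k; move: ajk; rewrite (@saturated _ [:: c 2]) //=.
  - by rewrite inE cn //; lia.
  - by rewrite /wsum /= a1 !mc; lia.
  by rewrite !inE negb_or jk.
have [->|j2] := eqVneq j (c k.-1); first by right.
move: ajk; rewrite (@saturated _ [:: c k.+1; c k.-1]) //=.
- by rewrite !inE !cn; lia.
- by rewrite /wsum /= a1 a2 // !mc; lia.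
by rewrite !inE !negb_or jk j1.
Qed.

(** All neighbours of the inner nodes of a chain lie on the chain, so a new
    neighbour of its last node is a new node. *)
Lemma chain_avoid N c x k : chain N c -> (2 < N)%N -> (0 < A x (c N))%N ->
  x != c N -> x != c N.-1 -> (0 < k <= N)%N -> x != c k.
Proof.
move=> ch N2 ax xN xN1 kN; apply/eqP => xk; subst x.
have cn := chain_neq ch.
have kN2 : (k < N.-1)%N by move: xN xN1; rewrite !cn; lia.
have aN : (0 < A (c N) (c k))%N by rewrite lt0n;
  apply: contraTneq ax => /A_eq0 ->.
have [||/eqP|[k1 /eqP]] := chain_neighbour ch _ _ aN.
- by lia.
- by rewrite cn; lia.
- by rewrite cn; lia.
by rewrite cn; lia.
Qed.

Lemma chain_bound N c : chain N c -> (N <= #|T|)%N.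
Proof.
move=> ch; have u : uniq [seq c k | k <- iota 1 N].
  rewrite map_inj_in_uniq ?iota_uniq // => j k; rewrite !mem_iota => jN kN.
  by move/eqP; rewrite (chain_neq ch) ?add1n // => /eqP.
by rewrite -[leqLHS](size_iota 1) -(size_map c) -(card_uniqP u) max_card.
Qed.

(** On a path from [x0] to [i] the marks go from 1 to 4 and never resume
    growing once they stop ([path_nonincreasing]); hence the path starts with
    1, 2, 3, 4. *)
Lemma first_chain i : m i = 4%N -> exists c, chain 4 c.
Proof.
move=> mi; have [p pp [up li]] := path_to i.
case: p pp up li => [|y p]; first by move=> _ _ e; rewrite -e m_x0 in mi.
move=> /= /andP[xy yp] /andP[xyp uyp] li.
have yi : i \in y :: p by rewrite -li mem_last.
have nxy : x0 != y by move: xyp; rewrite inE negb_or => /andP[].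
have ayx : (0 < A y x0)%N by move: xy; rewrite adjacent_sym => /andP[].
have [my a1 _] : [/\ m y = 2%N, A y x0 = 1%N & (1 < 1)%N -> 1%N = 1%N].
  have /wsum_le : uniq [:: x0; y] by rewrite /= inE nxy.
  rewrite /wsum /= addn0 m_x0 => le.
  have [m1|m1] := leqP (m y) 1%N; last exact: (@concave_mark 1 (m y) 1).
  have := path_nonincreasing xy yp; rewrite /= xyp uyp m_x0 => /(_ isT m1 i).
  move: yi; rewrite inE => /orP[/eqP e|-> /(_ isT)];
    first by rewrite -e mi in m1.
  by rewrite mi => /leq_trans/(_ m1).
case: p yp xyp uyp li yi => [|z p].
  by move=> _ _ _ _; rewrite inE => /eqP e; rewrite -e mi in my.
move=> /= /andP[yz zp] xyp /andP[yzp uzp] li yi.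
have [nyz nxz] : y != z /\ x0 != z.
  by move: yzp xyp; rewrite !inE !negb_or => /andP[-> _] /and3P[_ ->].
have azy : (0 < A z y)%N by move: yz; rewrite adjacent_sym => /andP[].
have axy : (0 < A x0 y)%N by move: xy => /andP[].
have zi : i \in z :: p.
  by move: yi; rewrite inE => /orP[/eqP e|//]; rewrite -e mi in my.
have [mz a2 /(_ isT) a3] : [/\ m z = 3%N, A z y = 1%N & (1 < 2)%N ->
  A x0 y = 1%N].
  have /wsum_le : uniq [:: y; x0;
    z] by rewrite /= !inE negb_or eq_sym nxy nyz nxz.
  rewrite /wsum /= addn0 m_x0 my => le.
  have [m1|m1] := leqP (m z) 2%N; last exact: concave_mark.
  have := path_nonincreasing yz zp; rewrite /= yzp uzp my => /(_ isT m1 i).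
  move: zi; rewrite inE => /orP[/eqP e|-> /(_ isT)];
    first by rewrite -e mi in m1.
  by rewrite mi => /leq_trans/(_ m1).
case: p zp xyp yzp uzp li yi zi => [|w p].
  by move=> _ _ _ _ _ _; rewrite inE => /eqP e; rewrite -e mi in mz.
move=> /= /andP[zw wp] xyp yzp /andP[zwp uwp] li yi zi.
have [nzw [nyw nxw]] : z != w /\ y != w /\ x0 != w.
  move: zwp yzp xyp; rewrite !inE !negb_or => /andP[-> _] /and3P[_ -> _].
  by move=> /and4P[_ _ ->].
have awz : (0 < A w z)%N by move: zw; rewrite adjacent_sym => /andP[].
have ayz : (0 < A y z)%N by move: yz => /andP[].
have azw : (0 < A z w)%N by move: zw => /andP[].
have wi : i \in w :: p.
  by move: zi; rewrite inE => /orP[/eqP e|//]; rewrite -e mi in mz.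
have [mw a4 /(_ isT) a5] : [/\ m w = 4%N, A w z = 1%N & (1 < 3)%N ->
  A y z = 1%N].
  have /wsum_le : uniq [:: z; y;
    w] by rewrite /= !inE negb_or eq_sym nyz nzw nyw.
  rewrite /wsum /= addn0 my mz => le.
  have [m1|m1] := leqP (m w) 3%N; last exact: concave_mark.
  have := path_nonincreasing zw wp; rewrite /= zwp uwp mz => /(_ isT m1 i).
  move: wi; rewrite inE => /orP[/eqP e|-> /(_ isT)];
    first by rewrite -e mi in m1.
  by rewrite mi => /leq_trans/(_ m1).
exists (nth x0 [:: x0; x0; y; z; w]); split=> //.
  by case=> [|[|[|[|[|k]]]]].
by case=> [|[|[|[|[|k]]]]].
Qed.

(** Only the nonzero bonds are prescribed: harmonicity makes the others vanish
    ([diagram_saturated]). *)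
Definition diagram (adj : seq (seq (nat * nat))) (mk : seq nat) (s : seq T) :=
  [/\ uniq s, head x0 s = x0, map m s = mk &
      forall k, (k < size mk)%N -> forall p, p \in nth [::] adj k ->
        A (nth x0 s p.1) (nth x0 s k) = p.2].

(** The harmonic condition for a table of bonds, decided by computation. *)
Definition harmonic_table (adj : seq (seq (nat * nat))) (mk : seq nat) :=
  all (fun k => [&& uniq (map fst (nth [::] adj k)),
      all (fun p => (p.1 < size mk) && (p.1 != k))%N (nth [::] adj k)
    & sumn [seq nth 0 mk p.1 * p.2 | p <- nth [::] adj k] == 2 * nth 0 mk k])%N
    (iota 0 (size mk)).

(** The default value 0 of [nth] is the bond of nodes that are not adjacent. *)
Definition entry (adj : seq (seq (nat * nat))) j k :=
  let r := nth [::] adj k in nth 0%N (map snd r) (index j (map fst r)).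

Lemma diagram_saturated adj mk s k j : harmonic_table adj mk ->
  diagram adj mk s -> (k < size mk)%N -> j != nth x0 s k ->
  j \notin [seq nth x0 s p.1 | p <- nth [::] adj k] -> A j (nth x0 s k) = 0%N.
Proof.
move=> /allP tab [us hs ms adjs] kl jk;
  have sz : size s = size mk by rewrite -ms size_map.
have /and3P[ua /allP la /eqP ha] := tab k ltac:(by rewrite mem_iota).
move=> js; apply: (@saturated _ [seq nth x0 s p.1 | p <- nth [::] adj k]).
- rewrite cons_uniq (map_comp (nth x0 s) fst) map_inj_in_uniq ?ua ?andbT.
    apply/negP => /mapP[_ /mapP[p pa ->]] /eqP; have /andP[pl pk] := la p pa.
    by rewrite nth_uniq ?sz // eq_sym (negPf pk).
  move=> _ _ /mapP[p pa ->] /mapP[q qa ->] /eqP.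
  have /andP[pl _] := la p pa; have /andP[ql _] := la q qa.
  by rewrite nth_uniq ?sz // => /eqP.
- rewrite -[in RHS](nth_map _ 0%N m) ?sz // ms -ha /wsum -map_comp.
  congr sumn; apply/eq_in_map => p pa /=; have /andP[pl _] := la p pa.
  by rewrite adjs // -(nth_map _ 0%N m) ?sz // ms.
by rewrite inE negb_or jk.
Qed.

Lemma diagram_full adj mk s : harmonic_table adj mk -> diagram adj mk s ->
  (0 < size mk)%N -> forall x, x \in s.
Proof.
move=> tab D mk0; have [us hs ms adjs] := D.
have sz : size s = size mk by rewrite -ms size_map.
suff st x : x \in [set y in s]%SET by move=> x; have := st x; rewrite inE.
move: x; apply: connected => [|j k]; rewrite !inE.
  by move: hs mk0; rewrite -sz; case: (s) => //= y r -> _; rewrite inE eqxx.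
move=> ks js; rewrite -(nth_index x0 ks).
have kl : (index k s < size mk)%N by rewrite -sz index_mem.
apply: (diagram_saturated tab D kl).
  by apply: contraNneq js => ->; rewrite nth_index.
apply: contra js => /mapP[p pa ->]; apply: mem_nth.
have /and3P[_ /allP la _] := allP tab _ (ltac:(by rewrite mem_iota) : index k s
  \in iota 0 (size mk)).
by have /andP[] := la p pa; rewrite sz.
Qed.

Lemma diagram_entry adj mk s j k : harmonic_table adj mk -> diagram adj mk s ->
  (j < size mk)%N -> (k < size mk)%N -> j != k ->
  A (nth x0 s j) (nth x0 s k) = entry adj j k.
Proof.
move=> tab D jl kl jk; have [us hs ms adjs] := D.
have sz : size s = size mk by rewrite -ms size_map.
have /and3P[ua /allP la _] := allP tab k ltac:(by rewrite mem_iota).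
rewrite /entry; set r := nth [::] adj k in ua la *.
have [jr|jr] := boolP (j \in map fst r).
  have il : (index j (map fst r) < size r)%N by rewrite -(size_map fst)
    index_mem.
  have pr := mem_nth (0, 0)%N il.
  have := adjs k kl _ pr; rewrite -(nth_map _ 0%N fst) // nth_index //.
  by move=> ->; rewrite (nth_map (0, 0)%N).
rewrite [RHS]nth_default; last first.
  by rewrite size_map -(size_map fst) leqNgt index_mem.
apply: (diagram_saturated tab D kl); first by rewrite nth_uniq ?sz.
apply: contra jr => /mapP[p pr /eqP]; have /andP[pl _] := la p pr.
by rewrite nth_uniq ?sz // => /eqP ->; apply: map_f.
Qed.

Definition adj_E7 : seq (seq (nat * nat)) :=
  [:: [:: (1, 1)]; [:: (0, 1); (3, 1)]; [:: (4, 1)]; [:: (1, 1); (4, 1)];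
      [:: (2, 1); (3, 1); (5, 1)]; [:: (4, 1); (6, 1)]; [:: (5, 1); (7, 1)];
      [:: (6, 1)]]%N.
Definition marks_E7 : seq nat := [:: 1; 2; 2; 3; 4; 3; 2; 1]%N.

Definition adj_E8 : seq (seq (nat * nat)) :=
  [:: [:: (8, 1)]; [:: (3, 1)]; [:: (4, 1)]; [:: (1, 1); (4, 1)];
      [:: (2, 1); (3, 1); (5, 1)]; [:: (4, 1); (6, 1)]; [:: (5, 1); (7, 1)];
      [:: (6, 1); (8, 1)]; [:: (7, 1); (0, 1)]]%N.
Definition marks_E8 : seq nat := [:: 1; 2; 3; 4; 6; 5; 4; 3; 2]%N.

Definition adj_F4 : seq (seq (nat * nat)) :=
  [:: [:: (1, 1)]; [:: (0, 1); (2, 1)]; [:: (1, 1); (3, 1)];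
      [:: (2, 2); (4, 1)]; [:: (3, 1)]]%N.
Definition marks_F4 : seq nat := [:: 1; 2; 3; 4; 2]%N.

Definition exceptional :=
  [\/ exists s, diagram adj_E7 marks_E7 s, exists s, diagram adj_E8 marks_E8 s
    | exists s, diagram adj_F4 marks_F4 s].

Lemma chain_extend N c y : chain N c -> (3 < N)%N -> (0 < A y (c N))%N ->
  A y (c N) = 1%N -> A (c N.-1) (c N) = 1%N -> m y = N.+1 ->
    (0 < A (c N) y)%N ->
  chain N.+1 (fun k => if k == N.+1 then y else c k).
Proof.
move=> [c1 mc e _] N3 ay a1 a2 my acy; split.
- by case: eqP => //; lia.
- by move=> k kN; case: eqP => [->//|nk]; apply: mc; lia.
- move=> k kN; have -> : (k == N.+1) = false by lia.
  rewrite eqSS; case: eqVneq => [->|nk].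
    by rewrite a1; split=> // _; have -> : (N.-1 == N.+1) = false by lia.
  have -> : (k.-1 == N.+1) = false by lia.
  by apply: e; lia.
by rewrite eqxx /=; have -> : (N == N.+1) = false by lia.
Qed.

(** The nodes of a diagram are listed as a chain followed by the other nodes,
    and then put in the standard order by [uniq_reorder]. *)
Lemma chain_uniq N c r : chain N c -> uniq r ->
  (forall z k, z \in r -> (0 < k <= N)%N -> z != c k) ->
  uniq (map c (iota 1 N) ++ r).
Proof.
move=> ch ur rc; rewrite cat_uniq ur andbT; apply/andP; split.
  rewrite map_inj_in_uniq ?iota_uniq // => j k; rewrite !mem_iota => jN kN.
  by move/eqP; rewrite (chain_neq ch) ?add1n // => /eqP.
apply/hasPn => z zr; apply/negP => /mapP[k]; rewrite mem_iota add1n ltnS => kN.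
by apply/eqP/rc.
Qed.

Lemma uniq_reorder (s : seq T) (r : seq nat) : uniq s -> uniq r ->
  all (fun k => k < size s)%N r -> uniq [seq nth x0 s k | k <- r].
Proof.
move=> us ur /allP rs; rewrite map_inj_in_uniq // => j k /rs jl /rs kl /eqP.
by rewrite nth_uniq // => /eqP.
Qed.

(** If [2 m(y) = m(x) + 1], the harmonic sum at [y] leaves 1 beside [x], that
    is a further neighbour of mark 1, which is too small a mark beside [y]. *)
Lemma half_mark x y : y != x -> (3 < m x)%N -> (0 < A x y)%N ->
  (2 * m y)%N != (m x).+1.
Proof.
move=> yx x3 ax; apply/eqP => my.
have u : uniq [:: y; x] by rewrite /= inE yx.
have := wsum_le u; rewrite /wsum /= addn0 my => le.
have a1 : A x y = 1%N by nia.
have [|z [zs az bz]] := new_neighbour u.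
  by rewrite /wsum /= a1 my; lia.
rewrite /wsum /= addn0 a1 my => le1 le2.
have : (m z <= 1)%N by nia.
by move: bz le2 my; clear -x3; nia.
Qed.

(** A double bond into the end of a chain leaves room for one more neighbour,
    of mark 2, only if [N = 4]. This is the extended diagram of F4. *)
Lemma double_bond N c y : chain N c -> (3 < N)%N -> A (c N.-1) (c N) = 2%N ->
  y \notin [:: c N; c N.-1] -> (0 < A y (c N))%N -> (0 < A (c N) y)%N ->
  (N.-1 * 2 + m y * A y (c N) <= 2 * N)%N -> (N * A (c N) y <= 2 * m y)%N ->
  exceptional.
Proof.
move=> ch N3 aw ys ay bY l1 l2.
have [eN my a1 b1] : [/\ N = 4, m y = 2, A y (c N) = 1 & A (c N) y = 1]%N.
  move: ay bY l1 l2 N3; move: (A _ _) (A _ _) (m y) => a b k; clear.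
  move=> a0 b0 l1 l2 N3; have k2 : (1 < k)%N by nia.
  have -> : a = 1%N by nia.
  by split=> //; nia.
subst N; have [c1 mc e _] := ch.
have away k : (0 < k <= 4)%N -> y != c k.
  move: ys; rewrite !inE negb_or => /andP[n1 n2]; exact: chain_avoid.
constructor 3; exists [:: c 1; c 2; c 3; c 4; y].
have [[e1 _] [e2 e2'] [e3 e3']] : [/\ _,
  _ & _] := And3 (e 1 isT) (e 2 isT) (e 3 isT).
split=> //.
- apply: (@chain_uniq 4 c [:: y]) => // z k; rewrite inE => /eqP ->;
  exact: away.
- by rewrite /= !mc // my.
case=> [|[|[|[|[|k]]]]] // _ p; rewrite !inE;
  do ?[case/orP]; move=> /eqP -> //=; by [exact: e2'|exact: e3'].
Qed.

(** A fork at the end of a chain with marks [N/2] and [N/2 + 1]. The node [x]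
    is a leaf, while [y] has one more neighbour [z], of mark 2; the harmonic
    sum at [z] bounds [N] by 6, and [N] is even. For [N = 4] one more node
    follows [z] (E7), for [N = 6] none (E8). *)
Lemma branch N c x y : chain N c -> (3 < N)%N -> A (c N.-1) (c N) = 1%N ->
  uniq [:: c N; c N.-1; x; y] ->
  A x (c N) = 1%N -> A y (c N) = 1%N -> (0 < A (c N) x)%N ->
    (0 < A (c N) y)%N ->
  (2 * m x)%N = N -> m y = (m x).+1 -> exceptional.
Proof.
move=> ch N3 aw us ax ay bx bY mx my; have [c1 mc e _] := ch.
have mN : m (c N) = N by apply: mc; rewrite leqnn andbT; apply: leq_trans N3.
have mN1 : m (c N.-1) = N.-1 by apply: mc; clear -N3; lia.
move: (us); rewrite /= !inE !negb_or.
move=> /and4P[/and3P[nNw nNx nNy] /andP[nwx nwy] nxy _].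
have awayx k : (0 < k <= N)%N -> x != c k.
  by move=> kN; apply: (chain_avoid ch _ _ _ _ kN);
    rewrite ?ax // 1?eq_sym // ltnW.
have awayy k : (0 < k <= N)%N -> y != c k.
  by move=> kN; apply: (chain_avoid ch _ _ _ _ kN);
    rewrite ?ay // 1?eq_sym // ltnW.
have ux : uniq [:: x; c N] by rewrite /= inE eq_sym nNx.
have uy : uniq [:: y; c N] by rewrite /= inE eq_sym nNy.
have bx1 : A (c N) x = 1%N.
  by have := wsum_le ux; rewrite /wsum /= mN; move: (A _ x) bx mx N3; clear;
    nia.
have by1 : A (c N) y = 1%N.
  by have := wsum_le uy; rewrite /wsum /= mN; move: (A _ y) bY mx my N3; clear;
    nia.
have satx j : j \notin [:: x; c N] -> A j x = 0%N.
  by apply: saturated => //; rewrite /wsum /= bx1 mN mx addn0 muln1.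
have [|z [zs az bz]] := new_neighbour uy.
  by rewrite /wsum /= by1 mN my; clear -mx; lia.
rewrite /wsum /= by1 mN addn0 my => lz1 lz2.
have [mz az1 bz1 N6] : [/\ m z = 2, A z y = 1, A y z = 1 & N = 4 \/ N = 6]%N.
  move: az bz lz1 lz2 mx N3; move: (A _ _) (A _ _) (m z) (m x) => a b k l;
    clear.
  move=> a0 b0 l1 l2 mx N3; have k2 : (1 < k)%N by nia.
  have ka : (k * a <= 2)%N by nia.
  have ek : k = 2%N by nia.
  have -> : a = 1%N by nia.
  have -> : b = 1%N by nia.
  by split=> //; nia.
move: zs; rewrite !inE negb_or => /andP[nzy nzN].
have nzx : z != x.
  by apply: contraTneq az => ->;
    rewrite (A_eq0 (satx y _)) // !inE negb_or eq_sym nxy eq_sym nNy.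
have awayz k : (0 < k <= N)%N -> z != c k.
  move=> kN; have [-> //|kneq] := eqVneq k N.
  apply/eqP => ezk; have kN' : (0 < k < N)%N by move: kN kneq; clear; lia.
  have := chain_neighbour ch kN' (awayy k kN); rewrite -ezk => /(_ bz).
  case=> [ey|[k1 ey]].
    by have := awayy k.+1; rewrite ey eqxx; move: kN'; clear; lia.
  by have := awayy k.-1; rewrite ey eqxx; move: kN' k1; clear; lia.
have uz : uniq [:: z; y] by rewrite /= inE nzy.
have satN j : j \notin [:: c N; c N.-1; x; y] -> A j (c N) = 0%N.
  apply: saturated => //; rewrite /wsum /= aw ax ay mN mN1 my addn0 !muln1.
  by move: mx N3; clear; lia.
have saty j : j \notin [:: y; c N; z] -> A j y = 0%N.
  apply: saturated => //; first by rewrite /= !inE negb_or eq_sym nNy eq_sym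
    nzy eq_sym nzN.
  by rewrite /wsum /= by1 az1 mN mz my; move: mx; clear; lia.
case: N6 => eN.
  have {}mx : m x = 2%N by move: eN mx; clear; lia.
  rewrite mx in my; subst N.
  have [|u [us' au bu]] := new_neighbour uz.
    by rewrite /wsum /= bz1 my mz.
  rewrite /wsum /= bz1 my mz addn0 => lu1 lu2.
  have [mu au1 bu1] : [/\ m u = 1, A u z = 1 & A z u = 1]%N.
    move: au bu lu1 lu2; move: (A _ _) (A _ _) (m u) => a b k; clear; move=> *.
    have ek : k = 1%N by nia.
    by subst k; split=> //; lia.
  move: us'; rewrite !inE negb_or => /andP[nuz nuy].
  have nux : u != x.
    apply: contraTneq bu => ->.
    by rewrite (satx z) // !inE negb_or nzx nzN.
  have awayu k : (0 < k <= 4)%N -> u != c k.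
    move=> kN; apply/eqP => euk; have [k4|k4] := eqVneq k 4%N.
      move: bu; rewrite euk k4 (satN z) // !inE !negb_or nzN nzx nzy.
      by rewrite awayz.
    have kN' : (0 < k < 4)%N by move: kN k4; clear; lia.
    have := chain_neighbour ch kN' (awayz k kN); rewrite -euk => /(_ bu).
    case=> [ey|[k1 ey]].
      by have := awayz k.+1; rewrite ey eqxx; move: kN'; clear; lia.
    by have := awayz k.-1; rewrite ey eqxx; move: kN' k1; clear; lia.
  constructor 1; exists [:: c 1; c 2; x; c 3; c 4; y; z; u].
  have [[e1 _] [e2 /(_ isT) e2'] [e3 /(_ isT) e3']] := And3 (e 1 isT) (e 2 isT)
    (e 3 isT).
  split=> //.
  - have u0 : uniq [:: x; y; z; u].
      by rewrite /= !inE !negb_or nxy eq_sym nzx eq_sym nux eq_sym nzy eq_sym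
        nuy eq_sym nuz.
    apply: (@uniq_reorder _ [:: 0; 1; 4; 2; 3; 5; 6; 7]
      (@chain_uniq 4 c [:: x; y; z; u] ch u0 _)) => // v k; rewrite !inE.
    by case/or4P => /eqP -> kN;
      [exact: awayx|exact: awayy|exact: awayz|exact: awayu].
  - by rewrite /= !mc // mx my mz mu.
  by case=> [|[|[|[|[|[|[|[|k]]]]]]]] // _ p; rewrite !inE; do ?[case/orP];
    move=> /eqP -> //=.
have {}mx : m x = 3%N by move: eN mx; clear; lia.
rewrite mx in my; subst N.
constructor 2; exists [:: c 1; z; x; y; c 6; c 5; c 4; c 3; c 2].
have [[e1 _] [e2 /(_ isT) e2'] [e3 /(_ isT) e3']] := And3 (e 1 isT) (e 2 isT)
  (e 3 isT).
have [[e4 /(_ isT) e4'] [e5 /(_ isT) e5']] := conj (e 4 isT) (e 5 isT).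
split=> //.
- have u0 : uniq [:: x; y; z].
    by rewrite /= !inE !negb_or nxy eq_sym nzx eq_sym nzy.
  apply: (@uniq_reorder _ [:: 0; 8; 6; 7; 5; 4; 3; 2; 1]
    (@chain_uniq 6 c [:: x; y; z] ch u0 _)) => // v k; rewrite !inE.
  by case/or3P => /eqP -> kN; [exact: awayx|exact: awayy|exact: awayz].
- by rewrite /= !mc // mx my mz.
by case=> [|[|[|[|[|[|[|[|[|k]]]]]]]]] // _ p; rewrite !inE; do ?[case/orP];
  move=> /eqP -> //=.
Qed.

(** With a simple bond into the last node [c N] the harmonic sum there leaves
    [N + 1], and every neighbour has mark at least [N/2]. So there is one
    neighbour of mark [N + 1], or two neighbours whose marks add up to [N +
    1]; [half_mark] excludes two equal marks [(N + 1)/2], or one such mark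
    with a double bond. *)
Lemma chain_step N c : chain N c -> (3 < N)%N ->
  exceptional \/ exists c', chain N.+1 c'.
Proof.
move=> ch N3; have [c1 mc e aN] := ch; have cn := chain_neq ch.
have xw : c N != c N.-1 by rewrite cn; move: N3; clear; lia.
have mx : m (c N) = N by apply: mc; move: N3; clear; lia.
have mw : m (c N.-1) = N.-1 by apply: mc; move: N3; clear; lia.
have u1 : uniq [:: c N; c N.-1] by rewrite /= inE xw.
have := wsum_le u1; rewrite /wsum /= addn0 mx mw => leN.
have aw : A (c N.-1) (c N) = 2%N \/ A (c N.-1) (c N) = 1%N.
  by move: aN leN N3; move: (A _ _) => a; clear; nia.
have [|y [ys ay bY l1 l2]] := new_neighbour u1.
  by rewrite /wsum /= addn0 mx mw; move: aw N3; clear => -[] ->; lia.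
move: l1; rewrite /wsum /= addn0 mx mw => l1; rewrite mx in l2.
case: aw => aw; rewrite aw in l1.
  left; apply: (double_bond ch N3 aw ys ay bY _ l2).
  by rewrite addnC.
have nyx : y != c N by move: ys; rewrite !inE negb_or => /andP[].
have halfy v : v != c N -> (0 < A (c N) v)%N -> (2 * m v)%N != N.+1.
  by move=> vN av; have := half_mark vN _ av; rewrite mx; apply.
have u2 : uniq [:: c N; y; c N.-1].
  by move: ys; rewrite /= !inE !negb_or xw [c N == y]eq_sym nyx /= => ->.
have [full|part] := eqVneq (m y * A y (c N))%N N.+1.
  have := halfy y nyx bY => hy.
  have [my a1] : m y = N.+1 /\ A y (c N) = 1%N.
    move: full hy ay l2 bY N3; move: (A y _) (A _ y) (m y) => a b k; clear.
    move=> full /eqP hy a0 l2 b0 N3; have kb : (N <= 2 * k)%N by nia.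
    have a3 : (a < 3)%N.
      rewrite ltnNge; apply/negP => a3.
      have : (k * 3 <= N.+1)%N by rewrite -full leq_mul2l a3 orbT.
      by move: kb N3; clear; lia.
    by have : a = 1%N \/ a = 2%N by [lia]; case=> ea; subst a; lia.
  right; exists (fun k => if k == N.+1 then y else c k).
  exact: chain_extend.
have [|y' [ys' ay' bY' l1' l2']] := new_neighbour u2.
  rewrite /wsum /= addn0 aw mx mw; move: l1 part N3; clear => l1 /eqP; lia.
rewrite mx in l2'.
have nyx' : y' != c N by move: ys'; rewrite !inE negb_or => /andP[].
have u3 : uniq [:: c N; y'; y; c N.-1].
  move: ys' u2; rewrite /= !inE !negb_or =>
    /and3P[n1 n2 n3] /and3P[/andP[-> ->] -> _].
  by rewrite [c N == y']eq_sym n1 n2 n3.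
have := wsum_le u3; rewrite /wsum /= addn0 aw mx mw => l3.
have [a1 a1' sN] : [/\ A y (c N) = 1, A y' (c N) = 1 & m y + m y' <= N.+1]%N.
  move: ay ay' bY bY' l2 l2' l3 N3.
  move: (A y _) (A y' _) (A _ y) (A _ y') (m y) (m y') => a a' b b' k k'; clear.
  move=> a0 a0' b0 b0' l2 l2' l3 N3.
  have kb : (N <= 2 * k)%N by nia.
  have kb' : (N <= 2 * k')%N by nia.
  have e1 : a = 1%N by nia.
  have e2 : a' = 1%N by nia.
  by subst a a'; split=> //; lia.
have sum : (m y + m y' = N.+1)%N.
  apply/eqP; rewrite eqn_leq sN ltnNge; apply/negP => sN'.
  have [|z [_ az bz l4 l5]] := new_neighbour u3.
    by rewrite /wsum /= addn0 aw mx mw a1 a1'; move: sN' N3; clear; lia.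
  move: l4 l5; rewrite /wsum /= addn0 aw mx mw a1 a1' => l4 l5.
  move: az bz l4 l5 sN' l2 l2' bY bY' N3.
  move: (A z _) (A _ z) (A _ y) (A _ y') (m y) (m y') (m z) => a b d f k l p;
    clear.
  move=> a0 b0 l4 l5 sN' l2 l2' d0 f0 N3.
  have : (N <= 2 * l)%N by nia.
  have : (N <= 2 * k)%N by nia.
  have : (p <= p * a)%N by rewrite leq_pmulr.
  have : (N <= N * b)%N by rewrite leq_pmulr.
  lia.
left; have hy := halfy _ nyx bY; have hy' := halfy _ nyx' bY'.
have kb : (N <= 2 * m y)%N by move: l2 bY; move: (A _ _) => b; clear; nia.
have kb' : (N <= 2 * m y')%N by move: l2' bY'; move: (A _ _) => b; clear; nia.
have [lt|lt|eq] := ltngtP (m y) (m y').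
- apply: (branch ch N3 aw _ a1 a1' bY bY'); last 2 first.
  + by move: hy hy' lt sum kb kb'; clear => /eqP ? /eqP; lia.
  + by move: hy hy' lt sum kb kb'; clear => /eqP ? /eqP; lia.
  have -> : [:: c N; c N.-1; y; y'] = [seq nth x0 [:: c N; y'; y;
    c N.-1] k | k <- [:: 0; 3; 2; 1]%N] by [].
  exact: uniq_reorder.
- apply: (branch ch N3 aw _ a1' a1 bY' bY); last 2 first.
  + by move: hy hy' lt sum kb kb'; clear => /eqP ? /eqP; lia.
  + by move: hy hy' lt sum kb kb'; clear => /eqP ? /eqP; lia.
  have -> : [:: c N; c N.-1; y'; y] = [seq nth x0 [:: c N; y'; y;
    c N.-1] k | k <- [:: 0; 3; 1; 2]%N] by [].
  exact: uniq_reorder.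
by case/eqP: hy; rewrite mul2n -addnn {2}eq sum.
Qed.

Lemma classification i : m i = 4%N -> exceptional.
Proof.
move=> /first_chain[c ch].
suff ind k N c' : chain N c' -> (3 < N)%N -> (#|T| - N < k)%N -> exceptional.
  exact: (ind _ _ _ ch isT (ltnSn _)).
elim: k N c' => // k IH N c' ch' N3 lt.
have [//|[c'' ch'']] := chain_step ch' N3.
apply: (IH _ _ ch''); first exact: leqW.
by have := chain_bound ch''; move: lt; clear; lia.
Qed.

End MarkedDiagrams.

(** * The extended Dynkin diagram *)

Section CartanIntegers.
Variables (R : realType) (g : lieAlgType R) (t : {vspace g}).
Local Notation tC := (cplx (subvs_of t)).
Local Notation dual := 'Hom(tC, R[i]^o).

Lemma QMnr (x y : g) k : Q x (y *+ k) = k%:R * Q x y.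
Proof. by rewrite raddfMn mulr_natl. Qed.

(** [(0, - u)] is [- i u]: this element of [t_C] represents the functional
    with covector [u] for the complex Killing form. *)
Lemma killing_imag (u : g) (z : cplx g) :
  killing ((0, - u) : cplx g) z = (- Q z.2 u) +i* Q z.1 u.
Proof.
have kD (x y w : cplx g) : killing x (y + w) = killing x y + killing x w.
  by have := killing_linear x 1 y w; rewrite !scale1r.
have kZ (x y : cplx g) (c : R[i]) : killing x (c *: y) = c * killing x y.
  have := killing_linear x c y 0; rewrite !addr0 => ->.
  have := killing_linear x 1 0 0; rewrite scale1r addr0 => /eqP.
  by rewrite -subr_eq0 scale1r opprD addrA subrr sub0r oppr_eq0 => /eqP ->;
    rewrite addr0.
have iE (x y : g) : ((x, y) : cplx g) = ((x,
  0) : cplx g) + (0 +i* 1 : R[i]) *: ((y, 0) : cplx g).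
  by congr (_, _) => /=; rewrite !(scale0r, scaler0, scale1r, subr0, addr0,
    add0r).
case: z => z1 z2 /=; rewrite [X in killing X _]iE [X in killing _ X]iE !(QC _
  u) /=.
have -> : ((0, 0) : cplx g) = 0 by [].
rewrite add0r killingC kZ killingC kD kZ !killing_cplx.
have kN z : killing (- u) z = Q u z.
  by apply: oppr_inj; rewrite -QNl unlock.
rewrite !kN !(QC u).
by apply/eqP; rewrite eq_complex /= ; apply/andP; split; apply/eqP; ring.
Qed.

Lemma covector_killing (a : dual) u (h : tC) : covector a u ->
  (a h : R[i]) = killing (tC_incl ((0, - vsproj t u) : tC)) (tC_incl h).
Proof.
case=> ut ->; have -> : tC_incl ((0, - vsproj t u) : tC) = (0, - u).
  by congr (_, _); rewrite /= vsprojK.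
by rewrite killing_imag.
Qed.

Lemma covector_cartan (a b : dual) u v (c : int) : covector a u ->
  covector b v ->
  2 * Q u v / Q v v = c%:~R -> cartan_integer (t := t) a b c.
Proof.
move=> au bv uv; have [ut _] := au; have [vt _] := bv.
exists (0, - vsproj t u), (0, - vsproj t v); split=> [h|h|].
- exact: covector_killing.
- exact: covector_killing.
rewrite -(covector_killing _ au) -(covector_killing _ bv);
  case: au bv => _ -> [_ ->].
rewrite /= vsprojK // Q0l !QNl !opprK QC.
rewrite -(rmorph_int (real_complex R)) -uv !rmorphM fmorphV /=.
rewrite Q0l; congr (_ * _ / _); exact: (rmorph_nat (real_complex R) 2).
Qed.

End CartanIntegers.

Section ExtendedDiagram.
Variables (R : realType) (g : lieAlgType R) (t : {vspace g}).
Hypotheses (hg : compact_simple g) (ht : maximal_abelian t).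
Local Notation tC := (cplx (subvs_of t)).
Local Notation dual := 'Hom(tC, R[i]^o).
Variables (n : nat) (alpha : 'I_n -> dual) (delta : dual).
Hypotheses (halpha : simple_roots alpha) (hdelta : highest_root alpha delta).
Variable m : 'I_n -> nat.
Hypothesis hm : delta = \sum_j alpha j *+ m j.
Variable K : 'I_n -> tC.
Hypothesis hK : forall j k, alpha j (K k) = (j == k)%:R.

Local Notation T := (option 'I_n).

(** The nodes of the extended diagram are indexed by [option 'I_n], with
    [None] for the node [- delta] of mark 1. *)
Definition xroot (k : T) : dual := if k is Some j then alpha j else - delta.
Definition xmark (k : T) : nat := if k is Some j then m j else 1%N.

Lemma eval_sum (k : 'I_n -> nat) l :
  ((\sum_j alpha j *+ k j) (K l) : R[i]) = (k l)%:R.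
Proof.
rewrite sum_lfunE (bigD1 l) //= big1 => [|j jl].
  by rewrite -scaler_nat scale_lfunE hK eqxx addr0 /GRing.scale /= mulr1.
by rewrite -scaler_nat scale_lfunE hK (negPf jl) scaler0.
Qed.

Lemma delta_eval l : (delta (K l) : R[i]) = (m l)%:R.
Proof. by rewrite hm eval_sum. Qed.

Lemma xroot_eval k l :
  (xroot k (K l) : R[i]) = if k is Some j then (j == l)%:R else - (m l)%:R.
Proof. by case: k => [j|] /=; rewrite ?hK // opp_lfunE delta_eval. Qed.

Lemma xroot_root k : is_root (xroot k).
Proof.
case: k => [j|] /=; first by case: halpha.
by apply: (is_rootN hg ht); case: hdelta.
Qed.

Lemma xmark_gt0 k : (0 < xmark k)%N.
Proof.
case: k => [j|] //=; case: hdelta => _ /(_ (alpha j))[|c cE];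
  first by case: halpha.
have /(congr1 (fun f : dual => (f (K j) : R[i]))) := cE.
rewrite add_lfunE opp_lfunE delta_eval hK eqxx eval_sum => /eqP.
by rewrite subr_eq -natrD eqr_nat addn1 => /eqP ->.
Qed.

Lemma xroot_inj : injective xroot.
Proof.
move=> [j|] [k|] // /(congr1 (fun f : dual => (f (K _) : R[i]))) e.
- have := e k; rewrite !xroot_eval eqxx; case: eqP => [->//|_] /eqP.
  by rewrite eq_sym oner_eq0.
- have := e j; rewrite !xroot_eval eqxx => /eqP.
  by rewrite -addr_eq0 -natrD pnatr_eq0.
have := e k; rewrite !xroot_eval eqxx => /esym/eqP.
by rewrite -addr_eq0 -natrD pnatr_eq0.
Qed.

Lemma xroot_relation : \sum_k xroot k *+ xmark k = 0.
Proof.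
rewrite (bigD1 None) //= mulr1n (reindex_omap Some id) /=; last by case.
rewrite (eq_bigl xpredT) => [|j]; last by rewrite eqxx.
by rewrite -hm addNr.
Qed.

(** Otherwise the difference of two nodes would be a root: it has coordinates
    of both signs if both nodes are simple roots, and it would put a root
    above [delta] if one node is [- delta]. *)
Lemma xroot_obtuse j k u v : j != k -> covector (xroot j) u ->
  covector (xroot k) v ->
  Q u v <= 0.
Proof.
(* The product is symmetric, so one may assume that [k] is a simple root,
   whose coroot then pairs positively with the other node. *)
wlog: j k u v / k != None.
  move=> W jk ju kv; have [k0|] := eqVneq k None; last by move/W; apply;
    [|exact: ju|].
  by rewrite QC; apply: (W k j) => //; rewrite -?k0 // eq_sym.
case: k => // k _ jk ju kv; rewrite leNgt; apply/negP => uv0.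
have [c [cE _]] := root_pair hg ht (xroot_root j) (xroot_root (Some k)) ju kv.
have c0 : 0 < c.
  rewrite -(ltr0z R) -cE; apply: divr_gt0; first by rewrite mulr_gt0.
  by apply: Q_gt0 => //; apply: (covector_neq0 hg ht) kv; exact: xroot_root.
move=> /(_ c0) rd.
have ev l : ((xroot j - xroot (Some k)) (K l) : R[i]) =
    (if j is Some j' then (j' == l)%:R else - (m l)%:R) - (k == l)%:R.
  by rewrite add_lfunE opp_lfunE !xroot_eval.
case: j jk {ju} rd ev => [j|] jk rd ev.
  have jk' : j != k by apply: contraNneq jk => ->.
  have nz : xroot (Some j) - xroot (Some k) <> 0.
    move/(congr1 (fun f : dual => (f (K j) : R[i])));
      rewrite ev zero_lfunE eqxx.
    by rewrite [k == j]eq_sym (negPf jk') subr0 => /eqP; rewrite oner_eq0.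
  case: halpha => _ _ /(_ _ (rd nz))[d [dE|dE]].
    have := ev k; rewrite dE eval_sum (negPf jk') eqxx sub0r => /eqP.
    by rewrite -addr_eq0 -natrD pnatr_eq0 addn1.
  have := ev j; rewrite dE opp_lfunE eval_sum [k == j]eq_sym (negPf jk') eqxx
    subr0.
  by move=> /esym/eqP; rewrite -addr_eq0 -natrD pnatr_eq0.
have nz : xroot None - xroot (Some k) <> 0.
  move/(congr1 (fun f : dual => (f (K k) : R[i])));
    rewrite ev zero_lfunE eqxx => /eqP.
  by rewrite -opprD oppr_eq0 -natrD pnatr_eq0 addn1.
have := is_rootN hg ht (rd nz); rewrite /= opprB opprK => rd'.
case: hdelta => _ /(_ _ rd')[d].
rewrite opprD addrCA subrr addr0 => /(congr1 (fun f : dual =>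
  (f (K k) : R[i]))).
rewrite opp_lfunE hK eqxx eval_sum => /esym/eqP.
by rewrite -addr_eq0 -natrD pnatr_eq0 addn1.
Qed.

Lemma xroot_covectors : exists u : T -> g, forall k, covector (xroot k) (u k).
Proof.
have /fin_all_exists[u hu] k := root_covector hg ht (xroot_root k).
by exists u.
Qed.

Lemma sum_covector (u : T -> g) (P : pred T) : (forall k,
  covector (xroot k) (u k)) ->
  covector (\sum_(k | P k) xroot k *+ xmark k) (\sum_(k | P k) u k *+ xmark k).
Proof. by move=> hu; apply: covector_sum => k; apply: covectorMn. Qed.

(** The covectors and the Cartan integers are chosen once for all nodes. *)
Definition cartan_matrix (u : T -> g) (C : T -> T -> int) :=
  (forall k, covector (xroot k) (u k)) /\
  (forall j k, 2 * Q (u j) (u k) / Q (u k) (u k) = (C j k)%:~R).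

Lemma cartan_matrix_exists : exists u C, cartan_matrix u C.
Proof.
have [u hu] := xroot_covectors; exists u.
have /fin_all_exists[C hC] : forall jk : T * T, exists c : int,
    2 * Q (u jk.1) (u jk.2) / Q (u jk.2) (u jk.2) = c%:~R.
  move=> [j k]; have [c [cE _ _]] :=
    root_pair hg ht (xroot_root j) (xroot_root k) (hu j) (hu k).
  by exists c.
by exists (fun j k => C (j, k)); split=> // j k; rewrite -hC.
Qed.

Variables (u : T -> g) (C : T -> T -> int).
Hypothesis huC : cartan_matrix u C.

Lemma u_gt0 k : 0 < Q (u k) (u k).
Proof.
case: huC => hu _; apply: Q_gt0 => //.
apply: (covector_neq0 hg ht) (hu k); exact: xroot_root.
Qed.

Lemma C_diag k : C k k = 2.
Proof.
case: huC => _ /(_ k k); rewrite mulfK ?gt_eqF ?u_gt0 // => /eqP.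
by rewrite -[2 in X in X -> _]/(2%:Z%:~R) eqr_int => /eqP <-.
Qed.

Lemma C_Q j k : (C j k)%:~R * Q (u k) (u k) = 2 * Q (u j) (u k).
Proof. by case: huC => _ <-; rewrite divfK // gt_eqF // u_gt0. Qed.

Lemma C_le0 j k : j != k -> C j k <= 0.
Proof.
move=> jk; case: huC => hu _; have := xroot_obtuse jk (hu j) (hu k).
rewrite -(lerz0 R) -(pmulr_rle0 _ (u_gt0 k)) mulrC C_Q => uv.
by rewrite pmulr_rle0.
Qed.

Lemma C_eq0 j k : C j k = 0 -> C k j = 0.
Proof.
move=> c0; have := C_Q j k; rewrite c0 mul0r => /esym/eqP.
rewrite mulf_eq0 pnatr_eq0 /= QC => /eqP q0; have := C_Q k j.
rewrite q0 mulr0 => /eqP; rewrite mulf_eq0 (gt_eqF (u_gt0 j)) orbF.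
by rewrite intr_eq0 => /eqP.
Qed.

Lemma u_relation : \sum_k u k *+ xmark k = 0.
Proof.
case: huC => hu _; apply: (covector_uniq hg (sum_covector xpredT hu)).
by rewrite xroot_relation; exact: covector0.
Qed.

Lemma u_relation_Q k : \sum_j (xmark j)%:R * Q (u j) (u k) = 0.
Proof.
have /(congr1 (Q (u k))) := u_relation; rewrite Q0r linear_sum /= => e.
rewrite -[RHS]e; apply: eq_bigr => j _.
by rewrite QMnr QC.
Qed.

Lemma C_relation k : \sum_j (xmark j)%:Z * C j k = 0.
Proof.
apply/eqP; rewrite -(intr_eq0 R) rmorph_sum /=.
rewrite (eq_bigr (fun j => (xmark j)%:R * Q (u j) (u k) * (2 / Q (u k) (u k)))).
  by rewrite -mulr_suml u_relation_Q mul0r.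
move=> j _; case: huC => _ hC; rewrite rmorphM /= -hC -pmulrn.
ring.
Qed.

Definition bond j k : nat := `|C j k|%N.

Lemma bond_eq0 j k : bond j k = 0%N -> bond k j = 0%N.
Proof. by move/eqP; rewrite absz_eq0 => /eqP/C_eq0 e; rewrite /bond e. Qed.

Lemma C_bond j k : j != k -> C j k = - (bond j k)%:Z.
Proof. by move/C_le0 => c0; rewrite /bond abszE ler0_norm // opprK. Qed.

Lemma bond_harmonic k :
  (\sum_(j | j != k) xmark j * bond j k = 2 * xmark k)%N.
Proof.
have := C_relation k; rewrite (bigD1 k) //= C_diag.
rewrite (eq_bigr (fun j => - (xmark j * bond j k)%:Z)) => [|j jk]; last first.
  by rewrite C_bond // mulrN.
rewrite sumrN => /eqP; rewrite subr_eq0 => /eqP e.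
by apply/eqP; rewrite -eqz_nat PoszM mulrC e (big_morph Posz PoszD erefl).
Qed.

(** If [S] is closed, the part [v] over [S] of the relation between the
    covectors is orthogonal to its own terms, hence 0; then the other part
    vanishes as well, which contradicts the independence of the simple roots
    unless it is empty. *)
Lemma bond_connected (S : {set T}) : None \in S ->
  (forall j k, k \in S -> j \notin S -> bond j k = 0%N) -> forall k, k \in S.
Proof.
move=> S0 cl k; case: huC => hu _.
pose v := \sum_(j in S) u j *+ xmark j.
have vu l : l \in S -> Q v (u l) = 0.
  move=> lS; rewrite QC linear_sum /= -[RHS](u_relation_Q l) [RHS](bigID (mem
    S)) /=.
  rewrite [X in _ + X]big1 ?addr0 => [|j jS].
    by apply: eq_bigr => j _; rewrite QMnr QC.
  have /eqP := C_Q j l; have := cl _ _ lS jS => /eqP;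
    rewrite absz_eq0 => /eqP ->.
  by rewrite mul0r eq_sym mulf_eq0 pnatr_eq0 /= => /eqP ->; rewrite mulr0.
have v0 : v = 0.
  apply: (Q_eq0 hg); rewrite {2}/v linear_sum /= big1 // => j jS.
  by rewrite QMnr vu // mulr0.
have b0 := covector_inj (sum_covector (mem S) hu) (_ : covector 0 _).
have {}b0 : \sum_(j in S) xroot j *+ xmark j = 0.
  by apply: b0; rewrite -/v v0; exact: covector0.
apply: contrapT => /negP kS; case: k kS => [k|] kS; last by rewrite S0 in kS.
have /(congr1 (fun f : dual => (f (K k) : R[i]))) := b0.
rewrite zero_lfunE sum_lfunE (bigD1 None) //= big1 => [|[j|] /andP[jS jk]] //.
  rewrite addr0 mulr1n opp_lfunE delta_eval => /eqP.
  by rewrite oppr_eq0 pnatr_eq0 -leqn0 leqNgt; have /= -> := xmark_gt0 (Some k).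
rewrite -scaler_nat scale_lfunE xroot_eval; case: eqP => [jk'|_];
  last by rewrite scaler0.
by rewrite jk' (negPf kS) in jS.
Qed.

Lemma extended_diagram i : m i = 4%N -> exceptional bond xmark None.
Proof.
move=> mi; apply: (@classification _ _ _ _ _ _ _ _ _ (Some i)) => //.
- exact: xmark_gt0.
- exact: bond_eq0.
- exact: bond_harmonic.
- exact: bond_connected.
Qed.

Lemma simple_separate x : x \in t -> (forall j, Q x (u (Some j)) = 0) -> x = 0.
Proof.
move=> xt xu; apply: (covectors_separate hg ht) => // b v rb bv.
have [[hu _] [_ _ /(_ b rb)[d bE]]] := (huC, halpha).
have su : covector (\sum_j alpha j *+ d j) (\sum_j u (Some j) *+ d j).
  by apply: covector_sum => j; apply: covectorMn; apply: (hu (Some j)).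
have Q0 : Q x (\sum_j u (Some j) *+ d j) = 0.
  by rewrite linear_sum /= big1 // => j _; rewrite QMnr xu mulr0.
case: bE => bE; rewrite bE in bv.
  by rewrite (covector_uniq hg bv su).
by rewrite (covector_uniq hg bv (covectorN su)) QNr Q0 oppr0.
Qed.

Lemma nodes_full adj mk s : harmonic_table adj mk ->
  diagram bond xmark None adj mk s -> (0 < size mk)%N -> forall k, k \in s.
Proof. exact: (diagram_full xmark_gt0 bond_harmonic bond_connected). Qed.

Lemma nodes_entry adj mk s j k : harmonic_table adj mk ->
  diagram bond xmark None adj mk s -> (j < size mk)%N -> (k < size mk)%N ->
  j != k -> bond (nth None s j) (nth None s k) = entry adj j k.
Proof. exact: (diagram_entry xmark_gt0 bond_harmonic). Qed.

End ExtendedDiagram.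

(** * Integral involutive symmetries of the three diagrams *)

Section Symmetries.
Local Open Scope nat_scope.
Variables (adj : seq (seq (nat * nat))) (mk : seq nat) (i : nat).

(** Conditions under which a permutation with first values [p] may be
    continued by [v]: it fixes [i] and preserves the bonds between nodes other
    than [i]. Testing them step by step keeps the search small. *)
Definition compatible (p : seq nat) v :=
  [&& v \notin p, (v == i) == (size p == i)
    & all (fun j => [|| j == i, size p == i
        | (entry adj (nth 0 p j) v == entry adj j (size p))
          && (entry adj v (nth 0 p j) == entry adj (size p) j)])
      (iota 0 (size p))].

Fixpoint partial_symmetries k : seq (seq nat) :=
  if k is k'.+1 then
    [seq rcons p v | p <- partial_symmetries k',
                     v <- [seq v <- iota 0 (size mk) | compatible p v]]
  else [:: [::]].

(** The last condition expresses that the image of node [i] has integral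
    coordinates; see [mark_congruence]. *)
Definition integral_involution (p : seq nat) :=
  [&& p != iota 0 (size mk),
      all (fun j => nth 0 p (nth 0 p j) == j) (iota 0 (size mk))
    & all (fun j => [|| j == 0, j == i
        | nth 0 mk (nth 0 p 0) * nth 0 mk j == nth 0 mk (nth 0 p j) %[mod 4]])
      (iota 0 (size mk))].

Definition symmetries :=
  [seq p <- partial_symmetries (size mk) | integral_involution p].

Lemma mem_partial_symmetries (p : seq nat) k : k <= size p ->
  (forall j, j < k -> nth 0 p j < size mk /\ compatible (take j p) (nth 0 p j))
    ->
  take k p \in partial_symmetries k.
Proof.
elim: k => [|k IH] kp pk; first by rewrite take0.
rewrite (take_nth 0) //=; apply/allpairsPdep.
exists (take k p), (nth 0 p k); split=> //.
  by apply: IH => [|j jk]; [exact: ltnW|apply: pk; exact: ltnW].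
by have [lt cp] := pk k (ltnSn k); rewrite mem_filter cp mem_iota.
Qed.

Lemma mem_symmetries (p : seq nat) : size p = size mk -> uniq p ->
  (forall j, j < size mk -> nth 0 p j < size mk) ->
  (forall j, j < size mk -> (nth 0 p j == i) = (j == i)) ->
  (forall j k, j < size mk -> k < size mk -> j != i -> k != i -> j != k ->
    entry adj (nth 0 p j) (nth 0 p k) = entry adj j k) ->
  integral_involution p -> p \in symmetries.
Proof.
move=> sp up pl pi pe ip; rewrite mem_filter ip /= -[p in p \in _](take_size)
  sp.
apply: mem_partial_symmetries; rewrite ?sp // => k kl; split; first exact: pl.
have sk : size (take k p) = k by rewrite size_takel // sp ltnW.
apply/and3P; rewrite sk; split.
- apply/negP => /(nthP 0)[j]; rewrite sk => jk; rewrite nth_take // => /eqP.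
  by rewrite nth_uniq ?sp ?(ltn_trans jk) // => /eqP ejk;
    rewrite ejk ltnn in jk.
- by rewrite pi.
apply/allP => j; rewrite mem_iota /= add0n => jk; rewrite nth_take //.
have [//|ji /=] := eqVneq j i; have [//|ki /=] := eqVneq k i.
have jl := ltn_trans jk kl; have njk : j != k by rewrite ltn_eqF.
by rewrite !pe ?eqxx // eq_sym.
Qed.

End Symmetries.

Lemma symmetries_E7_4 : symmetries adj_E7 marks_E7 4 =
  [:: [:: 3; 1; 2; 0; 4; 7; 6; 5]; [:: 5; 6; 2; 7; 4; 0; 1; 3];
      [:: 7; 6; 2; 5; 4; 3; 1; 0]]%N.
Proof. by vm_compute. Qed.

Lemma symmetries_E8_3 : symmetries adj_E8 marks_E8 3 =
  [:: [:: 2; 1; 0; 3; 8; 7; 6; 5; 4]]%N.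
Proof. by vm_compute. Qed.

Lemma symmetries_E8_6 : symmetries adj_E8 marks_E8 6 =
  [:: [:: 7; 1; 5; 3; 4; 2; 6; 0; 8]]%N.
Proof. by vm_compute. Qed.

Lemma symmetries_F4_3 : symmetries adj_F4 marks_F4 3 = [:: [:: 2; 1; 0; 3;
  4]]%N.
Proof. by vm_compute. Qed.

(** * The action of the involution on roots *)

Section InvolutionOnRoots.
Variables (R : realType) (g : lieAlgType R) (t : {vspace g}).
Hypotheses (hg : compact_simple g) (ht : maximal_abelian t).
Local Notation tC := (cplx (subvs_of t)).
Local Notation dual := 'Hom(tC, R[i]^o).
Variable tau : 'End(g).
Hypotheses (htau : lie_involution tau) (htau_t : (tau @: t)%VS = t).
Local Notation act := (root_act (t := t) tau).

Lemma tauK : involutive tau.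
Proof. by case: htau => _ tt _ x; rewrite -comp_lfunE tt id_lfunE. Qed.

Lemma tau_lie x y : tau (lie x y) = lie (tau x) (tau y).
Proof. by case: htau => -[]. Qed.

Lemma tau_Q x y : Q (tau x) (tau y) = Q x y.
Proof. by rewrite unlock killing_involution. Qed.

Lemma tau_t x : x \in t -> tau x \in t.
Proof. by move=> xt; rewrite -htau_t memv_img. Qed.

Lemma tau_inv x : (tau^-1)%VF x = tau x.
Proof.
rewrite -[in LHS](tauK x) lker0_lfunK //.
by apply/lker0P; exact: (can_inj tauK).
Qed.

(** The complexification of the restriction of [tau] to [t]. *)
Definition tauC (h : tC) : tC := (vsproj t (tau (vsval h.1)),
  vsproj t (tau (vsval h.2))).

Lemma actE (a : dual) h : (act a h : R[i]) = a (tauC h).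
Proof. by rewrite root_actE !tau_inv. Qed.

Lemma tauCK : involutive tauC.
Proof.
move=> h; rewrite /tauC /= !vsprojK ?tau_t ?subvsP // !tauK !vsvalK.
by case: h.
Qed.

Lemma actK : involutive act.
Proof. by move=> a; apply/lfunP => h; have := actE (act a) h;
  rewrite (actE a) tauCK. Qed.

Lemma act_covector a u : covector a u -> covector (act a) (tau u).
Proof.
case=> ut au; split; first exact: tau_t.
have e x : Q (tau x) u = Q x (tau u) by rewrite -[in LHS](tauK u) tau_Q.
by move=> h; rewrite actE au /= !vsprojK ?tau_t ?subvsP // !e.
Qed.

(** [tau] carries root vectors of [a] to root vectors of [act a]. *)
Lemma act_root a : is_root a -> is_root (act a).
Proof.
move=> [a0 [x x0 ax]]; split.
  move=> wa0; apply: a0; rewrite -(actK a) wa0; apply/lfunP => h.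
  by have := actE 0 h; rewrite !zero_lfunE.
exists (tau x.1, tau x.2).
  move=> [/(congr1 tau) + /(congr1 tau)]; rewrite !tauK linear0 => e1 e2.
  by apply: x0; case: (x) e1 e2 => /= ? ? -> ->.
move=> h; have /root_vectorP[e1 e2] := ax (tauC h).
apply/root_vectorP; rewrite actE; split=> /=.
  move/(congr1 tau): e1; rewrite linearB /= !tau_lie !vsprojK ?tau_t ?subvsP //
    !tauK => ->.
  by rewrite linearB !linearZ.
move/(congr1 tau): e2; rewrite linearD /= !tau_lie !vsprojK ?tau_t ?subvsP //
  !tauK => ->.
by rewrite linearD !linearZ.
Qed.

End InvolutionOnRoots.

(** * The permutation of the nodes *)

Section NodePermutation.
Variables (R : realType) (g : lieAlgType R) (t : {vspace g}).
Hypotheses (hg : compact_simple g) (ht : maximal_abelian t).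
Local Notation tC := (cplx (subvs_of t)).
Local Notation dual := 'Hom(tC, R[i]^o).
Variables (n : nat) (alpha : 'I_n -> dual) (delta : dual).
Hypotheses (halpha : simple_roots alpha) (hdelta : highest_root alpha delta).
Variable m : 'I_n -> nat.
Hypothesis hm : delta = \sum_j alpha j *+ m j.
Variable K : 'I_n -> tC.
Hypothesis hK : forall j k, alpha j (K k) = (j == k)%:R.
Variable i : 'I_n.
Hypothesis hmi : m i = 4%N.
Variable tau : 'End(g).
Hypotheses (htau : lie_involution tau) (htau_t : (tau @: t)%VS = t).
Local Notation act := (root_act (t := t) tau).
Hypothesis htau_Pi : act @` Pi_h alpha delta i = Pi_h alpha delta i.
Hypothesis htau_id : ~ {in t, forall x, tau x = x}.
Local Notation T := (option 'I_n).
Local Notation xroot := (xroot alpha delta).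
Local Notation xmark := (xmark m).

Lemma Pi_hP a : Pi_h alpha delta i a <-> exists2 k, k != Some i & a = xroot k.
Proof.
split=> [[->|[j /= /eqP ji <-]]|[[j|] ki ->]].
- by exists None.
- by exists (Some j) => //; apply: contra_not_neq ji => -[].
- by right; exists j => //=; apply/eqP; apply: contraNneq ki => ->.
by left.
Qed.

Lemma node_permutation_exists : exists p : T -> T, p (Some i) = Some i /\
  forall k, k != Some i -> p k != Some i /\ act (xroot k) = xroot (p k).
Proof.
have /fin_all_exists[p hp] (k : T) : exists k' : T, (k == Some i ->
  k' = Some i) /\
    (k != Some i -> k' != Some i /\ act (xroot k) = xroot k').
  have [->|ki] := eqVneq k (Some i); first by exists (Some i); rewrite eqxx.
  have : Pi_h alpha delta i (act (xroot k)).
    by rewrite -htau_Pi; exists (xroot k) => //; apply/Pi_hP; exists k.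
  by move=> /Pi_hP[k' k'i e]; exists k'.
exists p; split; first by have [/(_ (eqxx _))] := hp (Some i).
by move=> k; case: (hp k).
Qed.

Variable p : T -> T.
Hypothesis p_i : p (Some i) = Some i.
Hypothesis p_act : forall k, k != Some i ->
  p k != Some i /\ act (xroot k) = xroot (p k).

Lemma p_involutive : involutive p.
Proof.
move=> k; have [->|ki] := eqVneq k (Some i); first by rewrite !p_i.
have [pki e] := p_act ki; have [_ e'] := p_act pki.
by apply: (xroot_inj hm hK); rewrite -e' -e (actK htau htau_t).
Qed.

Lemma p_eq_i k : (p k == Some i) = (k == Some i).
Proof. by rewrite -{1}p_i (inj_eq (can_inj p_involutive)). Qed.

Lemma xroot_relation_eval h :
  \sum_k (xroot k h : R[i]) * (xmark k)%:R = 0.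
Proof.
have /(congr1 (fun f : dual => (f h : R[i]))) := xroot_relation hm.
rewrite zero_lfunE sum_lfunE => e; rewrite -[RHS]e; apply: eq_bigr => k _.
by rewrite -[in RHS]scaler_nat scale_lfunE mulrC.
Qed.

Lemma act_relation h :
  \sum_k (act (xroot k) h : R[i]) * (xmark k)%:R = 0.
Proof.
rewrite -[RHS](xroot_relation_eval (tauC tau h)); apply: eq_bigr => k _.
by rewrite (actE htau).
Qed.

(** The image of [alpha i] is a root, hence an integral combination of the
    [alpha j], whereas the relation between the nodes only determines four
    times that image. *)
Lemma mark_congruence l : l != i ->
  (xmark (p None) * m l == xmark (p (Some l)) %[mod 4])%N.
Proof.
move=> li; have := act_relation (K l); rewrite (bigD1 (Some i)) //=.
have [d dE] : exists d : int, (act (alpha i) (K l) : R[i]) = d%:~R.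
  have [_ _ span] := halpha.
  have /span[d [->|->]] : is_root (act (alpha i)).
    by apply: (act_root htau htau_t); case: halpha.
    by exists (d l); rewrite eval_sum.
  by exists (- (d l)%:Z); rewrite opp_lfunE eval_sum // rmorphN.
(* Evaluated at [K l], a node other than [i] contributes only if its image is
   [alpha l] or [- delta]. *)
rewrite dE hmi (reindex_inj (can_inj p_involutive)) /=.
rewrite (eq_bigl (fun k => k != Some i)) => [|k]; last by rewrite p_eq_i.
rewrite (bigD1 None) //= (bigD1 (Some l)) /=; last first.
  by rewrite andbT; apply: contraNneq li => -[->].
have act_p k : k != Some i -> act (xroot (p k)) = xroot k.
  by move=> ki; have [|_] := p_act (k := p k); rewrite ?p_eq_i // p_involutive.
have lSi : Some l != Some i by apply: contraNneq li => -[->].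
rewrite big1 => [|k /andP[/andP[ki kN] kl]]; last first.
  rewrite act_p // (xroot_eval hm hK); case: k ki kN kl => // k _ _ kl.
  have -> : (k == l) = false by apply: contraNF kl => /eqP ->.
  exact: mul0r.
rewrite !act_p // !(xroot_eval hm hK) eqxx addr0 mul1r mulNr -!natrM => e.
have : (d * 4 - (m l * xmark (p None))%:Z + (xmark (p (Some l)))%:Z)%:~R = 0 :>
  R[i].
  rewrite -[RHS]e !(rmorphD, rmorphN, rmorphM) /= -?pmulrn; ring.
move=> /eqP; rewrite intr_eq0 => /eqP;
  move: (xmark (p None)) (xmark (p (Some l))) (m l) => {e dE}; clear.
by move=> a b c; rewrite (mulnC a c); move: (c * a)%N => q; lia.
Qed.

(** If all nodes but [i] are fixed, so is [alpha i] by the relation between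
    the nodes; then [tau x - x] is orthogonal to all simple covectors for
    every [x] in [t]. *)
Lemma p_not_id : exists k, p k != k.
Proof.
apply: contrapT => /forallNP pid; apply: htau_id => x xt.
have {}pid k : p k = k by have /negP := pid k; rewrite negbK => /eqP.
have fixd k : act (xroot k) = xroot k.
  have [->|ki] := eqVneq k (Some i); last by have [_ ->] := p_act ki;
    rewrite pid.
  apply/lfunP => h; have four : (4%:R : R[i]) != 0 by rewrite pnatr_eq0.
  apply: (mulIf four); rewrite -hmi -[m i]/(xmark (Some i)).
  have := act_relation h; rewrite -[RHS](xroot_relation_eval h).
  rewrite (bigD1 (Some i)) //= [RHS](bigD1 (Some i)) //= => e.
  apply: (addIr _ (etrans e _)); congr (_ + _); apply: eq_bigr => l li.
  by have [_ ->] := p_act li; rewrite pid.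
apply/eqP; rewrite -subr_eq0; apply/eqP.
have [u [C huC]] := cartan_matrix_exists hg ht halpha hdelta.
have [hu _] := huC.
apply: (simple_separate hg ht halpha huC) => [|j].
  by rewrite memvB // (tau_t htau_t).
have tu : tau (u (Some j)) = u (Some j).
  apply: covector_uniq (hu (Some j)) => //; rewrite -fixd.
  exact: (act_covector htau htau_t (hu (Some j))).
by rewrite QDl QNl -{1}tu (tau_Q htau) subrr.
Qed.

Variables (u : T -> g) (C : T -> T -> int).
Hypothesis huC : cartan_matrix alpha delta u C.

Lemma p_bond j k : j != Some i -> k != Some i ->
  bond C (p j) (p k) = bond C j k.
Proof.
move=> ji ki; rewrite /bond; congr `|_|%N; apply/eqP; rewrite -(eqr_int R).
case: huC => hu hC.
have up l : l != Some i -> u (p l) = tau (u l).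
  move=> /p_act[_ e]; apply: (covector_uniq hg (hu (p l))); rewrite -e.
  exact: (act_covector htau htau_t (hu l)).
by rewrite -!hC !up // !(tau_Q htau).
Qed.

(** The permutation of the nodes, transported to the indices of the diagram. *)
Lemma node_symmetry adj mk s ii : harmonic_table adj mk ->
  diagram (bond C) xmark None adj mk s -> (ii < size mk)%N ->
  nth None s ii = Some i ->
  [seq index (p x) s | x <- s] \in symmetries adj mk ii.
Proof.
move=> tab D iil si; have [us hs ms _] := D.
have sz : size s = size mk by rewrite -ms size_map.
have mk0 : (0 < size mk)%N by apply: leq_ltn_trans iil.
have full := nodes_full hg ht halpha hdelta hm hK huC tab D mk0.
have s0 : nth None s 0 = None by case: (s) hs.
have nP j : (j < size mk)%N ->
    nth 0%N [seq index (p x) s | x <- s] j = index (p (nth None s j)) s.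
  by move=> jl; rewrite (nth_map None) ?sz.
have pl k : (index (p k) s < size mk)%N by rewrite -sz index_mem.
have sii j : (j < size mk)%N -> (nth None s j == Some i) = (j == ii).
  by move=> jl; rewrite -si nth_uniq ?sz.
apply: mem_symmetries.
- by rewrite size_map.
- rewrite map_inj_in_uniq // => j k _ _ /(congr1 (nth None s)).
  by rewrite !nth_index // => /(can_inj p_involutive).
- by move=> j jl; rewrite nP.
- by move=> j jl; rewrite nP // -sii // nth_index // p_eq_i sii.
- move=> j k jl kl ji ki jk; rewrite !nP //.
  have E j' k' := nodes_entry hg ht halpha hdelta hm hK huC (j := j') (k := k')
    tab D.
  have njk : index (p (nth None s j)) s != index (p (nth None s k)) s.
    apply: contra_neq jk => /(congr1 (nth None s)).
    rewrite !nth_index // => /(can_inj p_involutive) /eqP.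
    by rewrite nth_uniq ?sz // => /eqP.
  rewrite -!E // !nth_index // p_bond //; first by rewrite sii.
  by rewrite sii.
apply/and3P; split.
- have [k pk] := p_not_id; apply: contraNneq pk => e.
  have kl : (index k s < size mk)%N by rewrite -sz index_mem.
  have := nP _ kl; rewrite e nth_iota // add0n nth_index //.
  by move/(congr1 (nth None s)); rewrite !nth_index // => {2}->.
- apply/allP => j; rewrite mem_iota /= add0n => jl.
  by rewrite !nP // nth_index // p_involutive index_uniq ?sz.
apply/allP => j; rewrite mem_iota /= add0n => jl.
have [//|j0 /=] := eqVneq j 0%N; have [//|ji /=] := eqVneq j ii.
have mE x : nth 0%N mk (index x s) = xmark x.
  by rewrite -ms (nth_map None) ?index_mem // nth_index.
rewrite !nP // s0 !mE.
have -> : nth 0%N mk j = xmark (nth None s j) by rewrite -ms (nth_map None) ?sz.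
case sj : (nth None s j) => [l|] /=; last first.
  by move: j0; rewrite -(nth_uniq None _ _ us) ?sz // sj s0 eqxx.
apply: mark_congruence; apply: contraNneq ji => li.
by rewrite -sii // sj li.
Qed.

End NodePermutation.

(** * The center of the fixed subalgebra *)

Section CenterFixed.
Variables (R : realType) (g : lieAlgType R) (t : {vspace g}).
Hypotheses (hg : compact_simple g) (ht : maximal_abelian t).
Local Notation tC := (cplx (subvs_of t)).
Local Notation dual := 'Hom(tC, R[i]^o).
Variables (n : nat) (alpha : 'I_n -> dual) (delta : dual).
Hypotheses (halpha : simple_roots alpha) (hdelta : highest_root alpha delta).
Variable m : 'I_n -> nat.
Hypothesis hm : delta = \sum_j alpha j *+ m j.
Variable K : 'I_n -> tC.
Hypothesis hK : forall j k, alpha j (K k) = (j == k)%:R.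
Variable i : 'I_n.
Hypothesis hmi : m i = 4%N.
Variable sigma : 'End(g).
Hypothesis hsigma : Ad_exp ((0 +i* (pi / 2%:R)) *: K i) sigma.
Hypothesis hth : (t <= fixedSpace sigma)%VS.
Local Notation T := (option 'I_n).
Local Notation xroot := (xroot alpha delta).
Local Notation xmark := (xmark m).

(** [alpha_j (K i)] is 0 for [j <> i] and [delta (K i) = 4], so [sigma]
    rotates the plane of [x1] and [x2] by 0 or by [- 2 pi]. *)
Lemma fixed_rotation k u x1 x2 : k != Some i -> covector (xroot k) u ->
  rotation t u x1 x2 -> x1 \in fixedSpace sigma.
Proof.
move=> ki ku [_ _ _ rot]; have [X eX sX] := hsigma.
have : exists c : nat, Q (vsval X) u = - (pi *+ 2 *+ c) /\ (c <= 1)%N.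
  have := covector_real X ku; rewrite eX linearZ /= (xroot_eval hm hK).
  case: k ki {ku} => [j|] ki /=.
    have -> : (j == i) = false by apply: contraNF ki => /eqP ->.
    by rewrite scaler0 => -[] e; exists 0%N; rewrite -e mulr0n oppr0.
  rewrite hmi => e; exists 1%N; split=> //; move: e.
  rewrite -(rmorph_nat (real_complex R)) /GRing.scale /= => -[_] <-.
  by rewrite mulr1n -mulr_natr; field.
move=> [c [Qc c1]].
have [e1 e2] := rot _ (subvsP X).
have := exp_rotation sX (x1 := x1) (x2 := x2) (th := Q (vsval X) u).
rewrite !adE => /(_ e1 e2); rewrite Qc cosN sinN.
have [-> ->] : cos (pi *+ 2 *+ c : R) = 1 /\ sin (pi *+ 2 *+ c : R) = 0.
  by case: c c1 {Qc} => [|[|//]] _;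
    rewrite ?mulr0n ?mulr1n ?cos0 ?sin0 ?cos2pi ?sin2pi.
rewrite scale1r oppr0 scale0r subr0 => e; exact/fixedSpaceP.
Qed.

Lemma center_fixed_eq0 z : lie_center (fixedSpace sigma) z -> z = 0.
Proof.
move=> [_ zh]; have zt : z \in t.
  by apply: mem_t => // y yt; rewrite lieC zh ?oppr0 // (subvP hth).
have [u [C huC]] := cartan_matrix_exists hg ht halpha hdelta.
have [hu _] := huC.
have Qz k : k != Some i -> Q z (u k) = 0.
  move=> ki; have [v [x1 [x2 [kv _ rot]]]] := root_rotation hg ht (xroot_root
    hg ht halpha hdelta k).
  rewrite (covector_uniq hg (hu k) kv).
  have x1f := fixed_rotation ki kv rot; have [_ x20 _ /(_ z zt)[e _]] := rot.
  move: e; rewrite zh // => /esym/eqP;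
    rewrite scaler_eq0 (negPf x20) orbF oppr_eq0.
  by move/eqP.
(* The relation between the nodes, where [alpha i] has the nonzero mark 4. *)
have Qzi : Q z (u (Some i)) = 0.
  have : Q z (\sum_k u k *+ xmark k) = 0.
    by rewrite (u_relation hg hm huC) Q0r.
  rewrite linear_sum /= (bigD1 (Some i)) //= big1 => [|k ki].
    by rewrite QMnr addr0 /= hmi => /eqP; rewrite mulf_eq0 pnatr_eq0 => /eqP.
  by rewrite QMnr Qz // mulr0.
apply: (simple_separate hg ht halpha huC) => // j.
by have [->|/Qz] := eqVneq (Some j) (Some i).
Qed.

End CenterFixed.

(** * The image of the deleted node *)

Section LastImage.
Variables (R : rcfType) (V : vectType R[i]).
Implicit Types (a : seq 'Hom(V, R[i]^o)).

(** The factor 4 is the mark of the deleted node; [r] and [r'] are the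
    relation between the nodes and its image. *)
Lemma lfun_eq_of_sums (f f' : 'Hom(V, R[i]^o)) (r r' : V -> R[i]) (c : R[i]) :
  (forall h, r h = 0) -> (forall h, r' h = 0) ->
  (forall h, ((f h : R[i]) - f' h) * 4 = r' h - c * r h) -> f = f'.
Proof.
move=> r0 r'0 e; apply/lfunP => h; apply/eqP; rewrite -subr_eq0.
have /eqP := e h; rewrite r0 r'0 mulr0 subr0 mulf_eq0.
by rewrite (pnatr_eq0 _ 4) orbF.
Qed.

Lemma lfunMnE (f : 'Hom(V,
  R[i]^o)) k h : ((f *+ k) h : R[i]) = (f h : R[i]) * k%:R.
Proof. by rewrite -scaler_nat scale_lfunE mulrC. Qed.

Variable act : 'Hom(V, R[i]^o) -> 'Hom(V, R[i]^o).

Definition acts_by a mk ii (q : seq nat) :=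
  [/\ forall j, (j < size mk)%N -> j != ii -> act a`_j = a`_(nth 0%N q j),
    forall h, \sum_(j <- iota 0 (size mk)) (a`_j h : R[i]) * (nth 0%N mk j)%:R
      = 0
  & forall h, \sum_(j <- iota 0 (size mk)) (act a`_j h : R[i]) * (nth 0%N mk
    j)%:R = 0].

(* The coefficient [c] is the mark of the image of the node [- delta]:
   subtracting [c] times the relation from its image eliminates [- delta]. *)
Ltac last_image w c :=
  let e := fresh in let r := fresh in let r' := fresh in let z := fresh in
  move=> [e r r']; do ?split; try (by rewrite e);
  apply: (lfun_eq_of_sums (c := c) r r') => h;
  rewrite /= !big_cons !big_nil; move: w => z;
  rewrite ?e //= ?add_lfunE ?lfunMnE; ring.

Lemma acts_by_type_I a : acts_by a marks_E7 4 [:: 7; 6; 2; 5; 4; 3; 1; 0]%N ->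
  type_I act a.
Proof. last_image (act a`_4) (1 : R[i]). Qed.

Lemma acts_by_type_II a : acts_by a marks_E7 4 [:: 3; 1; 2; 0; 4; 7; 6; 5]%N ->
  type_II act a.
Proof. last_image (act a`_4) (3 : R[i]). Qed.

Lemma acts_by_type_III a : acts_by a marks_E7 4 [:: 5; 6; 2; 7; 4; 0; 1; 3]%N ->
  type_III act a.
Proof. last_image (act a`_4) (3 : R[i]). Qed.

Lemma acts_by_type_IV a :
  acts_by a marks_E8 3 [:: 2; 1; 0; 3; 8; 7; 6; 5; 4]%N -> type_IV act a.
Proof. last_image (act a`_3) (3 : R[i]). Qed.

Lemma acts_by_type_V a :
  acts_by a marks_E8 6 [:: 7; 1; 5; 3; 4; 2; 6; 0; 8]%N -> type_V act a.
Proof. last_image (act a`_6) (3 : R[i]). Qed.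

Lemma acts_by_type_VI a : acts_by a marks_F4 3 [:: 2; 1; 0; 3; 4]%N ->
  type_VI act a.
Proof. last_image (act a`_3) (3 : R[i]). Qed.

End LastImage.

(** * From the abstract diagram to the simple roots *)

Section ReadingOff.
Variables (R : realType) (g : lieAlgType R) (t : {vspace g}).
Hypotheses (hg : compact_simple g) (ht : maximal_abelian t).
Local Notation tC := (cplx (subvs_of t)).
Local Notation dual := 'Hom(tC, R[i]^o).
Variables (n : nat) (alpha : 'I_n -> dual) (delta : dual).
Hypotheses (halpha : simple_roots alpha) (hdelta : highest_root alpha delta).
Variable m : 'I_n -> nat.
Hypothesis hm : delta = \sum_j alpha j *+ m j.
Variable K : 'I_n -> tC.
Hypothesis hK : forall j k, alpha j (K k) = (j == k)%:R.
Variable i : 'I_n.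
Hypothesis hmi : m i = 4%N.
Variable tau : 'End(g).
Hypotheses (htau : lie_involution tau) (htau_t : (tau @: t)%VS = t).
Local Notation act := (root_act (t := t) tau).
Hypothesis htau_Pi : act @` Pi_h alpha delta i = Pi_h alpha delta i.
Hypothesis htau_id : ~ {in t, forall x, tau x = x}.
Local Notation T := (option 'I_n).
Local Notation xroot := (xroot alpha delta).
Local Notation xmark := (xmark m).
Variables (u : T -> g) (C : T -> T -> int).
Hypothesis huC : cartan_matrix alpha delta u C.

Variables (adj : seq (seq (nat * nat))) (mk : seq nat) (s : seq T).
Hypotheses (tab : harmonic_table adj mk)
  (D : diagram (bond C) xmark None adj mk s) (mk0 : (0 < size mk)%N).

Let full := nodes_full hg ht halpha hdelta hm hK huC tab D mk0.
Let sz : size s = size mk.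
Proof. by case: D => _ _ <- _; rewrite size_map. Qed.
Let us : uniq s. Proof. by case: D. Qed.

Lemma nodes_seq : exists2 r : seq 'I_n, perm_eq r (enum 'I_n)
  & extended_roots alpha delta r = map xroot s.
Proof.
exists (pmap id s).
  apply: uniq_perm; rewrite ?enum_uniq //.
    by apply: (@pmap_uniq _ _ id Some) us => -[].
  by move=> j; rewrite mem_enum mem_pmap map_id full.
have s0 : head None s = None by case: D.
have : (0 < size s)%N by rewrite sz.
case: s s0 us => [//|x r /= ->] /=; rewrite /extended_roots => /andP[nr _] _.
congr (_ :: _); elim: r nr => [//|k r IH]; rewrite inE negb_or => /andP[nk nr].
by case: k nk => //= j _; rewrite IH.
Qed.

Lemma nodes_cartan_integer j k :
  cartan_integer (xroot j) (xroot k) (C j k).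
Proof. by case: huC => hu hC; apply: (covector_cartan (hu j) (hu k)). Qed.

(** The hypothesis compares the two tables by computation. *)
Lemma nodes_dynkin (c : nat -> nat -> int) :
  all (fun j => all (fun k =>
    c j k == if j == k then 2 else - (entry adj j k)%:Z)
    (iota 1 (size mk).-1)) (iota 1 (size mk).-1) ->
  dynkin_type (size mk).-1 c (map xroot s).
Proof.
move=> tabc; split; first by rewrite size_map sz prednK.
move=> j k jl kl; rewrite !(nth_map None) ?sz; try by move: mk0 jl kl; clear;
  lia.
have jl' : (j < size mk)%N by move: mk0 jl; clear; lia.
have kl' : (k < size mk)%N by move: mk0 kl; clear; lia.
have mi x : (0 < x <= (size mk).-1)%N -> x \in iota 1 (size mk).-1.
  by rewrite mem_iota add1n ltnS.
have /allP/(_ k (mi k kl))/eqP -> := allP tabc j (mi j jl).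
case: eqVneq => [->|jk].
  by rewrite -(C_diag hg ht halpha hdelta huC (nth None s k));
    exact: nodes_cartan_integer.
rewrite -(nodes_entry hg ht halpha hdelta hm hK huC tab D jl' kl' jk).
rewrite -(C_bond hg ht halpha hdelta hm hK huC) ?nth_uniq ?sz //;
  exact: nodes_cartan_integer.
Qed.

Lemma sum_nodes (V : nmodType) (F : T -> V) :
  \sum_k F k = \sum_(j <- iota 0 (size mk)) F (nth None s j).
Proof.
rewrite -sz -[RHS]/(\sum_(j <- iota 0 (size s) | xpredT j) F (nth None s j)).
rewrite -[size s]subn0 -(big_nth None xpredT) [RHS]big_uniq //=.
by apply: eq_bigl => k; rewrite full.
Qed.

Lemma nodes_mark j : (j < size mk)%N -> nth 0%N mk j = xmark (nth None s j).
Proof. by case: D => _ _ <- _ jl;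
  rewrite (nth_map None) // -(size_map xmark). Qed.

Lemma nodes_act ii : (ii < size mk)%N -> nth None s ii = Some i ->
  exists2 q, q \in symmetries adj mk ii & acts_by act (map xroot s) mk ii q.
Proof.
move=> iil si; have [p [p_i p_act]] := node_permutation_exists htau_Pi.
exists [seq index (p x) s | x <- s].
  exact: (node_symmetry hg ht halpha hdelta hm hK hmi htau htau_t htau_id p_i
    p_act huC tab D).
split.
- move=> j jl ji.
  have pl : (index (p (nth None s j)) s < size mk)%N by rewrite -sz index_mem.
  rewrite !(nth_map None) ?sz //.
  rewrite nth_index //; have [|_ -> //] := p_act (nth None s j).
  by rewrite -si nth_uniq ?sz.
- move=> h; rewrite -[RHS](xroot_relation_eval hm h) sum_nodes.
  apply: eq_big_seq => j; rewrite mem_iota => /= jl.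
  by rewrite nodes_mark // (nth_map None) ?sz.
move=> h; rewrite -[RHS](act_relation hm htau h) sum_nodes.
apply: eq_big_seq => j; rewrite mem_iota => /= jl.
by rewrite nodes_mark // (nth_map None) ?sz.
Qed.

End ReadingOff.

(** * The six types *)

Theorem proposition4p1 (R : realType) (g : lieAlgType R)
    (hg : compact_simple g)
    (t : {vspace g}) (ht : maximal_abelian t)
    (n : nat) (alpha : 'I_n -> 'Hom(cplx (subvs_of t), R[i]^o))
    (halpha : simple_roots alpha)
    (delta : 'Hom(cplx (subvs_of t), R[i]^o))
    (hdelta : highest_root alpha delta)
    (m : 'I_n -> nat) (hm : delta = \sum_j alpha j *+ m j)
    (K : 'I_n -> cplx (subvs_of t))
    (hK : forall j k, alpha j (K k) = (j == k)%:R)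
    (i : 'I_n) (hmi : m i = 4%N)
    (sigma : 'End(g))
    (hsigma : Ad_exp ((0 +i* (pi / 2%:R)) *: K i) sigma)
    (hth : (t <= fixedSpace sigma)%VS)
    (tau : 'End(g)) (htau : lie_involution tau)
    (htau_h : (tau @: fixedSpace sigma)%VS = fixedSpace sigma)
    (htau_t : (tau @: t)%VS = t)
    (htau_Pi : root_act tau @` Pi_h alpha delta i = Pi_h alpha delta i)
    (htau_id : ~ {in t, forall x, tau x = x}) :
  (forall z, lie_center (fixedSpace sigma) z -> z = 0) /\
  exists s : seq 'I_n, perm_eq s (enum 'I_n) /\
    let a := extended_roots alpha delta s in
    let act := root_act (t := t) tau in
    [\/ [/\ dynkin_type 7 cartan_E a, a`_4 = alpha i
          & [\/ type_I act a, type_II act a | type_III act a]],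
        [/\ dynkin_type 8 cartan_E a, a`_3 = alpha i & type_IV act a],
        [/\ dynkin_type 8 cartan_E a, a`_6 = alpha i & type_V act a]
      | [/\ dynkin_type 4 cartan_F4 a, a`_3 = alpha i & type_VI act a]].
Proof.
split.
  exact: (center_fixed_eq0 hg ht halpha hdelta hm hK hmi hsigma hth).
have [u [C huC]] := cartan_matrix_exists hg ht halpha hdelta.
have seqP := nodes_seq hg ht halpha hdelta hm hK huC.
have dynP := nodes_dynkin hg ht halpha hdelta hm hK huC.
have actP := nodes_act hg ht halpha hdelta hm hK hmi htau htau_t htau_Pi
  htau_id huC.
have fullP := nodes_full hg ht halpha hdelta hm hK huC.
have markP s mk adj j : diagram (bond C) (xmark m) None adj mk s ->
    nth None s j = Some i -> (j < size mk)%N -> nth 0%N mk j = 4%N.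
  case=> _ _ <- _ sj; rewrite size_map => jl.
  by rewrite (nth_map None) // sj /= hmi.
have rootP s j : (j < size s)%N -> nth None s j = Some i ->
    (map (xroot alpha delta) s)`_j = alpha i.
  by move=> jl sj; rewrite (nth_map None) // sj.
have indexP adj mk s : harmonic_table adj mk -> (0 < size mk)%N ->
    diagram (bond C) (xmark m) None adj mk s ->
    exists j, [/\ (j < size mk)%N, nth None s j = Some i & nth 0%N mk j = 4%N].
  move=> tab mk0 D; have si := fullP _ _ _ tab D mk0 (Some i).
  have sz : size s = size mk by case: D => _ _ <- _; rewrite size_map.
  exists (index (Some i) s); rewrite -sz index_mem nth_index //; split=> //.
  by apply: (markP s mk adj _ D); rewrite ?nth_index // -sz index_mem.
have E7 : harmonic_table adj_E7 marks_E7 by [].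
have E8 : harmonic_table adj_E8 marks_E8 by [].
have F4 : harmonic_table adj_F4 marks_F4 by [].
have [[s D]|[s D]|[s D]] := extended_diagram hg ht halpha hdelta hm hK huC hmi.
- have [j [jl sj mj]] := indexP _ _ _ E7 isT D.
  have [r pr er] := seqP _ _ _ E7 D isT; exists r; split=> //; cbv zeta;
    rewrite er.
  have ej : j = 4%N by move: j jl mj {sj}; do 8 case=> //.
  subst j; constructor 1; split.
  + exact: (dynP _ _ _ E7 D isT).
  + by apply: rootP; case: D => _ _ ms _; rewrite // -(size_map (xmark m)) ms.
  have [q] := actP _ _ _ E7 D isT _ jl sj; rewrite symmetries_E7_4 !inE.
  case/or3P => /eqP ->.
  + by move/acts_by_type_II; constructor 2.
  + by move/acts_by_type_III; constructor 3.
  by move/acts_by_type_I; constructor 1.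
- have [j [jl sj mj]] := indexP _ _ _ E8 isT D.
  have [r pr er] := seqP _ _ _ E8 D isT; exists r; split=> //; cbv zeta;
    rewrite er.
  have dyn := dynP _ _ _ E8 D isT cartan_E isT.
  have sz : (size s = 9)%N by case: D => _ _ ms _;
    rewrite -(size_map (xmark m)) ms.
  have [q] := actP _ _ _ E8 D isT _ jl sj.
  have [ej|ej] : j = 3%N \/ j = 6%N.
    by case: j jl mj {sj} => [|[|[|[|[|[|[|[|[|j]]]]]]]]] //; [left|right].
  + subst j; rewrite symmetries_E8_3 inE => /eqP -> /acts_by_type_IV.
    by constructor 2; split=> //; apply: rootP; rewrite ?sz.
  subst j; rewrite symmetries_E8_6 inE => /eqP -> /acts_by_type_V.
  by constructor 3; split=> //; apply: rootP; rewrite ?sz.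
have [j [jl sj mj]] := indexP _ _ _ F4 isT D.
have [r pr er] := seqP _ _ _ F4 D isT; exists r; split=> //; cbv zeta;
  rewrite er.
have ej : j = 3%N by move: j jl mj {sj}; do 5 case=> //.
subst j; constructor 4; split.
- exact: (dynP _ _ _ F4 D isT).
- by apply: rootP; case: D => _ _ ms _; rewrite // -(size_map (xmark m)) ms.
have [q] := actP _ _ _ F4 D isT _ jl sj; rewrite symmetries_F4_3 inE.
by move/eqP -> => /acts_by_type_VI.
Qed.
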